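(* Let $k$ be an algebraically closed field of characteristic $2$ and let $G$ be a finite group of even order. Let $V$ be a $2$-subgroup of $G$ and let $Z$ be an indecomposable $kV$-module with vertex $V$ which is of symmetric type. Then among the indecomposable components of $\mathrm{Ind}_V^G Z$ which have vertex $V$, there is a distinguished $kG$-module $M$ characterised by any one of: (a) $M$ has multiplicity one as a component of $\mathrm{Ind}_V^G Z$. (b) $M$ has odd multiplicity as a component of $\mathrm{Ind}_V^G Z$. (c) $Z$ is a $B$-component of $\mathrm{Res}_V^G M$, for some $G$-form $B$ on $M$. (d) Each $V$-projective form on $\mathrm{Ind}_V^G Z$ is non-degenerate on $M$.
   Context: All modules are finite-dimensional left modules. A component of a module is a module isomorphic to a direct summand of it. A $G$-form on a $kG$-module $M$ is a non-degenerate $G$-invariant symmetric bilinear form $B:M\times M\to k$ (symplectic forms, i.e. those with $B(m,m)=0$ for all $m$, are included, since they are symmetric in characteristic $2$); then $(M,B)$ is a symmetric $kG$-module and $M$ has symmetric type. The same terms are used for subgroups of $G$. For a $kV$-module $Z$ and a $G$-form $B$ on $M$, $Z$ is a $B$-component of $\mathrm{Res}_V^G M$ if $\mathrm{Res}_V^G M$ has a submodule isomorphic to $Z$ on which $B$ is non-degenerate. A symmetric $kG$-module $(L,B_L)$ is a component of $(M,B)$ if there is a form-preserving $kG$-homomorphism $(L,B_L)\to(M,B)$. For $H\le G$ and a symmetric $kH$-module $(L,B_L)$, $\mathrm{Ind}_H^G(L,B_L)$ is $\mathrm{Ind}_H^G L$ with the form $B_L^G(g_1\otimes \ell_1,g_2\otimes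 \ell_2)=B_L(g_2^{-1}g_1\ell_1,\ell_2)$ if $g_1H=g_2H$ and $0$ otherwise. A $G$-form $B$ on $M$ is $H$-projective if $(M,B)$ is a component of $\mathrm{Ind}_H^G(L,B_L)$ for some symmetric $kH$-module $(L,B_L)$. In (d), a form on $\mathrm{Ind}_V^GZ$ is said to be non-degenerate on $M$ if its restriction to some direct summand of $\mathrm{Ind}_V^G Z$ isomorphic to $M$ is non-degenerate. A vertex of an indecomposable $kG$-module is a Green vertex: a subgroup $V$ of $G$ minimal subject to the module being isomorphic to a direct summand of $\mathrm{Ind}_V^GL$ for some $kV$-module $L$.
   Formalization: In (a) and (b) the characterisation is among self-dual components only: non-self-dual components of vertex V may also have multiplicity one (e.g. G = C_6, V = C_2, Z = k), so (a) and (b) alone do not determine M as printed. *)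

(* Defs.v *)
From HB Require Import structures.
From mathcomp Require Import all_boot all_order all_algebra all_fingroup.
From mathcomp Require Import mxrepresentation character.

Set Implicit Arguments.
Unset Strict Implicit.
Unset Printing Implicit Defensive.

Import GRing.Theory.
Local Open Scope group_scope.
Local Open Scope ring_scope.

(* A finite-dimensional left kG-module is an M : representation k G, with     *)
(* carrier the space 'cV[k]_(rdegree M) of COLUMN vectors, on which g \in G   *)
(* acts on the left by v |-> M g *m v. The library notions mx_rsim            *)
(* (isomorphism), dadd_grepr (direct sum) and subg_repr (restriction) do not  *)
(* depend on the side; the library's mxmodule and submod_repr refer to the    *)
(* right action on row vectors and are not used.                              *)

Section Modules.

Variables (k : fieldType) (gT : finGroupType).
Implicit Types G H V W : {group gT}.

Definition module_hom G (M N : representation k G)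
    (f : 'M[k]_(rdegree N, rdegree M)) : Prop :=
  {in G, forall g, f *m M g = N g *m f}.
Global Arguments module_hom {G} M N f.

Definition submodule G (M : representation k G)
    (U : {vspace 'cV[k]_(rdegree M)}) : Prop :=
  {in G, forall g, {in U, forall u, M g *m u \in U}}.
Global Arguments submodule {G} M U.

Definition direct_summand G (M : representation k G)
    (U : {vspace 'cV[k]_(rdegree M)}) : Prop :=
  submodule M U /\ exists W : {vspace 'cV[k]_(rdegree M)},
    [/\ submodule M W, (U + W = fullv)%VS & (U :&: W = 0)%VS].
Global Arguments direct_summand {G} M U.

Definition isom_submodule G (L M : representation k G)
    (U : {vspace 'cV[k]_(rdegree M)}) : Prop :=
  exists f : 'M[k]_(rdegree M, rdegree L),
    [/\ module_hom L M f, injective (mulmx f : 'cV_(rdegree L) -> _)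
      & forall u, u \in U <-> exists v, u = f *m v].
Global Arguments isom_submodule {G} L M U.

Definition indecomposable G (M : representation k G) : Prop :=
  (0 < rdegree M)%N /\
  forall M1 M2 : representation k G, mx_rsim M (dadd_grepr M1 M2) ->
    rdegree M1 = 0%N \/ rdegree M2 = 0%N.

Definition component G (L M : representation k G) : Prop :=
  exists N : representation k G, mx_rsim M (dadd_grepr L N).

(* The multiplicity of an indecomposable module, in the sense of the          *)
(* Krull-Schmidt theorem.                                                     *)
Definition has_multiplicity G (L M : representation k G) (m : nat) : Prop :=
  exists2 N : representation k G,
    mx_rsim M (dadd_grepr (muln_grepr L m) N) & ~ component L N.

Definition res G H (sHG : H \subset G) (M : representation k G) :
    representation k H :=
  Representation (subg_repr M sHG).

Lemma dual_mx_repr G (M : representation k G) :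
  mx_repr G (fun g => (M g^-1%g)^T).
Proof.
split=> [|x y Gx Gy]; first by rewrite invg1 repr_mx1 trmx1.
by rewrite invMg repr_mxM ?groupV // trmx_mul.
Qed.

(* The contragredient module, in coordinates for the dual basis.              *)
Definition dual G (M : representation k G) : representation k G :=
  Representation (MxRepresentation (dual_mx_repr M)).

Definition self_dual G (M : representation k G) : Prop := mx_rsim M (dual M).

Section Induction.

Variables (G H : {group gT}) (sHG : H \subset G).

Definition coset_rep (i : 'I_#|lcosets H G|) : gT :=
  repr (enum_val i : {set gT}).

Lemma coset_repP i : enum_val i = (coset_rep i *: H)%g.
Proof.
have /lcosetsP[x _ Di] := enum_valP i.
by rewrite /coset_rep Di; apply/esym/lcoset_eqP/(mem_repr x)/lcoset_refl.
Qed.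

Lemma coset_rep_in i : coset_rep i \in G.
Proof.
have /lcosetsP[x Gx Di] := enum_valP i.
have: coset_rep i \in (x *: H)%g by rewrite -Di coset_repP lcoset_refl.
by case/lcosetP=> h Hh ->; rewrite groupM // (subsetP sHG).
Qed.

Lemma coset_rep_ex x : x \in G ->
  exists i, forall j, ((coset_rep j)^-1 * x \in H)%g = (j == i).
Proof.
move=> Gx; have xH : (x *: H)%g \in lcosets H G by apply/lcosetsP; exists x.
exists (enum_rank_in xH (x *: H)%g) => j.
rewrite -mem_lcoset -coset_repP -(inj_eq enum_val_inj) enum_rankK_in //.
rewrite coset_repP eq_sym; apply/idP/eqP => [/lcoset_eqP-> //|<-].
exact: lcoset_refl.
Qed.

Variable L : representation k H.
Local Notation n := (rdegree L).

Definition repr0 (x : gT) : 'M[k]_n := if x \in H then L x else 0.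

Lemma repr0M x h : h \in H -> repr0 (x * h)%g = repr0 x *m L h.
Proof.
rewrite /repr0 => Hh; rewrite groupMr //.
by case: ifP => Hx; rewrite ?repr_mxM ?mul0mx.
Qed.

Definition ind_mx (g : gT) : 'M[k]_(\sum_(i < #|lcosets H G|) n) :=
  \mxblock_(i, j) repr0 ((coset_rep i)^-1 * (g * coset_rep j)).

Lemma repr0_sum i x : x \in G ->
  forall y, \sum_j repr0 ((coset_rep i)^-1 * (y * coset_rep j)) *m
            repr0 ((coset_rep j)^-1 * x)
  = repr0 ((coset_rep i)^-1 * (y * x)).
Proof.
move=> Gx y; have [j0 Dj0] := coset_rep_ex Gx.
rewrite (bigD1 j0) //= big1 ?addr0 => [|j /negPf nj]; last first.
  by rewrite {2}/repr0 Dj0 nj mulmx0.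
have Hj: ((coset_rep j0)^-1 * x \in H)%g by rewrite Dj0.
by rewrite {2}/repr0 Hj -repr0M // -!mulgA mulKVg.
Qed.

Lemma ind_mx_repr : mx_repr G ind_mx.
Proof.
split=> [|x y Gx Gy].
  apply/mxblockP=> i j; rewrite mxblockK mul1g.
  have [l Dl] := coset_rep_ex (coset_rep_in j).
  have /eqP Ejl : j == l by rewrite -Dl mulVg. subst l.
  rewrite /repr0 Dl; case: eqVneq => [->|neq_il].
    rewrite mulVg repr_mx1; apply/matrixP=> a b.
    rewrite !mxE; congr (_ *+ nat_of_bool _).
    by rewrite -[RHS](inj_eq val_inj) tagnat.eq_Rank eqxx.
  apply/matrixP=> a b; rewrite !mxE -[_ == _](inj_eq val_inj).
  by rewrite tagnat.eq_Rank (negPf neq_il).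
rewrite mul_mxblock; apply/eq_mxblockP=> i j.
by rewrite repr0_sum ?groupM ?coset_rep_in // -!mulgA.
Qed.

(* kG \otimes_{kH} L: block i of a vector is its component in the subspace    *)
(* coset_rep i \otimes L.                                                     *)
Definition ind : representation k G :=
  Representation (MxRepresentation ind_mx_repr).

(* The vector x \otimes l of ind, for x \in G.                                *)
Definition tens (x : gT) (l : 'cV[k]_n) : 'cV[k]_(rdegree ind) :=
  \mxcol_i (repr0 ((coset_rep i)^-1 * x) *m l).

Lemma ind_tens g x l : x \in G -> ind g *m tens x l = tens (g * x)%g l.
Proof.
move=> Gx; rewrite /= mul_mxblock_mxrow; apply/eq_mxcolP => i.
by under eq_bigr do rewrite mulmxA; rewrite -mulmx_suml repr0_sum.
Qed.

Lemma tensM x h l : h \in H -> tens (x * h)%g l = tens x (L h *m l).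
Proof. by move=> Hh; apply/eq_mxcolP => i; rewrite mulmxA -repr0M // mulgA. Qed.

Lemma tens_sum (u : 'cV[k]_(rdegree ind)) :
  u = \sum_i tens (coset_rep i) (submxcol u i).
Proof.
rewrite -mxcol_sum -[LHS]submxcolK; apply/eq_mxcolP=> i.
rewrite (bigD1 i) //= mulVg /repr0 group1 repr_mx1 mul1mx big1 ?addr0 // => j.
have [l Dl] := coset_rep_ex (coset_rep_in j).
have /eqP Ejl : j == l by rewrite -Dl mulVg. subst l.
by rewrite Dl eq_sym => /negPf->; rewrite mul0mx.
Qed.

(* The form B^G induced by a form B on L; see ind_form_tens.                  *)
Definition ind_form (B : 'cV[k]_n -> 'cV[k]_n -> k)
    (u v : 'cV[k]_(rdegree ind)) : k :=
  \sum_i B (submxcol u i) (submxcol v i).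

End Induction.

Definition relatively_projective G (M : representation k G) H : Prop :=
  exists (sHG : H \subset G) (L : representation k H), component M (ind sHG L).

Definition is_vertex G (M : representation k G) V : Prop :=
  relatively_projective M V /\
  forall W, W \proper V -> ~ relatively_projective M W.

Section Forms.

Local Notation form_on M := {symmetric 'cV[k]_(rdegree M)}.

Definition Gform G (M : representation k G) (B : form_on M) : Prop :=
  nondegenerate B /\
  {in G, forall g u v, B (M g *m u) (M g *m v) = B u v}.
Global Arguments Gform {G} M B.

Lemma ind_form_tens G H (sHG : H \subset G) (L : representation k H)
    (B : form_on L) g1 g2 l1 l2 : Gform L B -> g1 \in G -> g2 \in G ->
  ind_form B (tens sHG g1 l1) (tens sHG g2 l2) =
    if (g1 *: H == g2 *: H)%g then B (L (g2^-1 * g1)%g *m l1) l2 else 0.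
Proof.
case=> _ Binv Gg1 Gg2; have [i Di] := coset_rep_ex H Gg2.
rewrite /ind_form (bigD1 i) //= big1 => [|j /negPf nj]; last first.
  by rewrite !mxcolK {2}/repr0 Di nj mul0mx linear0r.
have Hi: ((coset_rep i)^-1 * g2 \in H)%g by rewrite Di.
rewrite addr0 !mxcolK {2}/repr0 Hi.
rewrite (sameP eqP lcoset_eqP) mem_lcoset /repr0.
have -> : ((coset_rep i)^-1 * g1 = ((coset_rep i)^-1 * g2) * (g2^-1 * g1))%g.
  by rewrite -!mulgA mulKVg.
rewrite groupMl //; case: ifP => Hg; last by rewrite mul0mx linear0l.
by rewrite repr_mxM // -mulmxA Binv.
Qed.

Definition symmetric_type G (M : representation k G) : Prop :=
  exists B : form_on M, Gform M B.

Definition nondegenerate_on G (M : representation k G) (B : form_on M)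
    (U : {vspace 'cV[k]_(rdegree M)}) : Prop :=
  (U :&: orthov B U = 0)%VS.
Global Arguments nondegenerate_on {G} M B U.

Definition B_component G V (sVG : V \subset G) (M : representation k G)
    (B : form_on M) (Z : representation k V) : Prop :=
  exists U : {vspace 'cV[k]_(rdegree M)},
    [/\ submodule (res sVG M) U, isom_submodule Z (res sVG M) U
      & nondegenerate_on M B U].
Global Arguments B_component {G V} sVG M B Z.

(* B is H-projective: (M, B) is a component of some Ind_H^G (L, BL).          *)
Definition projective_form G H (sHG : H \subset G) (M : representation k G)
    (B : form_on M) : Prop :=
  exists (L : representation k H) (BL : form_on L), Gform L BL /\
    exists f : 'M[k]_(rdegree (ind sHG L), rdegree M),
      module_hom M (ind sHG L) f /\
      forall u v, ind_form BL (f *m u) (f *m v) = B u v.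
Global Arguments projective_form {G H} sHG M B.

Definition nondegenerate_on_summand G (M N : representation k G)
    (B : form_on M) : Prop :=
  exists U : {vspace 'cV[k]_(rdegree M)},
    [/\ direct_summand M U, isom_submodule N M U & nondegenerate_on M B U].
Global Arguments nondegenerate_on_summand {G} M N B.

End Forms.

End Modules.

(* Main.v *)
Require Import Defs.
From HB Require Import structures.
From mathcomp Require Import all_boot all_order all_algebra all_fingroup.
From mathcomp Require Import all_solvable mxrepresentation character.
From Stdlib Require Import Classical.

(** Let X be the module induced from Z, with the inclusion j of Z and the
    projection q onto it, and let B be the form on X induced from a form A on
    Z. An endomorphism of an indecomposable module has a single eigenvalue, and
    this eigenvalue is a ring homomorphism to k whose kernel consists of the
    non-units. For an endomorphism phi of X put

      Q(phi) = eigenvalue of A^-1 (phi j)^T B (phi j),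

    the pullback of B along phi, compared with A (norm_char).

    The picture behind Q is the following. Modulo its radical and the traces
    from proper subgroups of V, the endomorphism ring of X is the quotient by
    its radical of the group algebra of T/V, where T is the stabiliser of Z in
    N_G(V). Square roots are unique in characteristic two, so the basis can be
    normalised to make the adjoint g -> g^-1. Then Q(phi) is the coefficient at
    1 of the product of the adjoint of phi with phi, which is the sum of the
    squares of the coefficients of phi, that is, the square of its
    augmentation. The module M is the component that belongs to the trivial
    module of T/V. The proof uses Q alone.

    The main identity (form_norm_mul) says that for a G-invariant symmetric form
    D on X, possibly degenerate, and a V-map g from Z to X, the pullback of D
    along g has the eigenvalue of the pullback of D along j times that of the
    pullback of B along g. To see it, expand g along the blocks of X. The group
    V permutes the pairs of blocks; a non-trivial orbit contributes a trace from
    a proper subgroup, which is not invertible because Z has vertex V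
    (equivariant_sum), and the fixed pairs off the diagonal cancel by symmetry in
    characteristic two (equivariant_sum_symmetric). Consequently Q is additive
    and multiplicative, and it is invariant under the adjoint
    (norm_char_adjoint).

    Call a component fX distinguished when Q(f) is not 0. Additivity yields an
    indecomposable distinguished component; multiplicativity shows that it is
    unique up to isomorphism and has multiplicity one, and Q vanishes on traces
    from proper subgroups of V, so that its vertex is V. Invariance under the
    adjoint makes every non-degenerate invariant form on X non-degenerate on it
    (distinguished_form_unit), which gives (d), self-duality and (c).

    Conversely, (c) forces Q(f) to be non-zero by the main identity
    (source_component_distinguished). In the other cases there is a map u from N
    to X along which B pulls back to a non-degenerate form: for (d) one uses B
    itself, and if N is self-dual of odd multiplicity, B induces a
    non-degenerate symmetric form on the multiplicity space, which is not
    alternating since the dimension is odd (odd_multiplicity_nondegenerate).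
    Then the self-adjoint projection f onto the image of u satisfies Q(f) = 1
    (nondegenerate_distinguished): write f as the product of its adjoint with
    itself and expand over the blocks as before, this time with the traces to G
    of V-endomorphisms of N. What remains is controlled by the fact that such a
    trace can be invertible only for endomorphisms of rank at least dim Z
    (source_rank). *)

Set Implicit Arguments.
Unset Strict Implicit.
Unset Printing Implicit Defensive.

Import GRing.Theory.
Local Open Scope group_scope.
Local Open Scope ring_scope.

(** * Sums in characteristic two *)

Section CharacteristicTwo.

Variable k : fieldType.
Hypothesis char2 : 2%N \in [pchar k].

Lemma sum_involution (I : finType) (P : pred I) (s : I -> I) (F : I -> k) :
  involutive s -> (forall i, P (s i) = P i) -> (forall i, P i -> F (s i) = F i) ->
  \sum_(i | P i) F i = \sum_(i | P i && (s i == i)) F i.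
Proof.
move=> sK Ps Fs; rewrite (bigID (fun i => s i == i)) /=.
rewrite [X in _ + X](bigID (fun i => enum_rank i < enum_rank (s i))%N) /=.
set T := \sum_(i | _ && (_ < _)%N) _; set T' := \sum_(i | _ && ~~ (_ < _)%N) _.
suffices -> : T' = T by rewrite addrr_pchar2 ?addr0.
rewrite /T (reindex_inj (inv_inj sK)); apply: eq_big => [i | i]; last first.
  by case/andP=> /andP[Pi _] _; rewrite Fs.
rewrite Ps sK -!andbA; congr (_ && _).
have [// | ne_si] := eqVneq (s i) i.
rewrite /= -leqNgt leq_eqVlt.
by rewrite (inj_eq val_inj) (inj_eq enum_rank_inj) (negPf ne_si).
Qed.

Lemma odd_involution_fixpoint n (s : 'I_n -> 'I_n) :
  odd n -> involutive s -> exists i, s i = i.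
Proof.
move=> odd_n sK; suff: [exists i, s i == i] by case/existsP=> i /eqP; exists i.
apply: contraTT odd_n => /existsPn nofix.
suff: n%:R = 0 :> k by move/eqP; rewrite -(dvdn_pcharf char2) dvdn2.
rewrite -[n in n%:R]card_ord -sumr_const.
rewrite (@sum_involution _ xpredT _ (fun=> 1) sK) ?big1 // => i.
by rewrite (negPf (nofix i)).
Qed.

(** The terms of the Leibniz formula for a permutation and for its inverse
    agree by symmetry, so that only involutions contribute; in odd size each
    involution fixes an index, which brings in a diagonal entry. *)
Lemma det_odd_alternating n (S : 'M[k]_n) :
  odd n -> S^T = S -> (forall i, S i i = 0) -> \det S = 0.
Proof.
move=> odd_n symS diagS; rewrite /determinant.
rewrite (@sum_involution _ xpredT (fun s => s^-1)%g _ invgK) //= => [|s _].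
  rewrite big1 // => s /eqP sV.
  have [|i Di] := odd_involution_fixpoint (s := s) odd_n.
    by move=> i; rewrite -{1}sV permK.
  by rewrite (bigD1 i) //= Di diagS mul0r mulr0.
rewrite odd_permV; congr (_ * _).
rewrite (reindex_inj (@perm_inj _ s)); apply: eq_bigr => i _ /=.
by rewrite permK -[in LHS]symS mxE.
Qed.

End CharacteristicTwo.

(** * Intertwining matrices, components and idempotents *)

Section Components.

Variables (k : fieldType) (gT : finGroupType).
Implicit Types G H : {group gT}.

(** The two functions need not be representations of the same group: a module
    and its restrictions share their underlying function, so that a map of
    V-modules from Z to a kG-module is an instance without any cast. *)
Definition intertwines (A : {set gT}) n1 n2 (rho1 : gT -> 'M[k]_n1)
    (rho2 : gT -> 'M[k]_n2) (f : 'M[k]_(n2, n1)) : Prop :=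
  {in A, forall a, f *m rho1 a = rho2 a *m f}.

Section Intertwiners.

Variables (A : {set gT}) (n1 n2 n3 : nat).
Variables (rho1 : gT -> 'M[k]_n1) (rho2 : gT -> 'M[k]_n2).
Variable (rho3 : gT -> 'M[k]_n3).

Lemma intertwines1 : intertwines A rho1 rho1 1%:M.
Proof. by move=> a _; rewrite mul1mx mulmx1. Qed.

Lemma intertwinesM f g : intertwines A rho1 rho2 f ->
  intertwines A rho2 rho3 g -> intertwines A rho1 rho3 (g *m f).
Proof. by move=> hf hg a Aa; rewrite -mulmxA hf // !mulmxA hg. Qed.

Lemma intertwinesD f g : intertwines A rho1 rho2 f ->
  intertwines A rho1 rho2 g -> intertwines A rho1 rho2 (f + g).
Proof. by move=> hf hg a Aa; rewrite mulmxDl mulmxDr hf ?hg. Qed.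

Lemma intertwinesN f : intertwines A rho1 rho2 f ->
  intertwines A rho1 rho2 (- f).
Proof. by move=> hf a Aa; rewrite mulNmx mulmxN hf. Qed.

Lemma intertwinesZ c f : intertwines A rho1 rho2 f ->
  intertwines A rho1 rho2 (c *: f).
Proof. by move=> hf a Aa; rewrite -scalemxAl -scalemxAr hf. Qed.

Lemma intertwines0 : intertwines A rho1 rho2 0.
Proof. by move=> a _; rewrite mul0mx mulmx0. Qed.

Lemma intertwinesS (B : {set gT}) f : B \subset A ->
  intertwines A rho1 rho2 f -> intertwines B rho1 rho2 f.
Proof. by move/subsetP=> sBA hf b Bb; apply/hf/sBA. Qed.

Lemma intertwines_sum I r (P : pred I) (F : I -> 'M[k]_(n2, n1)) :
  (forall i, P i -> intertwines A rho1 rho2 (F i)) ->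
  intertwines A rho1 rho2 (\sum_(i <- r | P i) F i).
Proof.
move=> hF; elim/big_rec: _ => [|i f Pi hf]; first exact: intertwines0.
by apply: intertwinesD => //; apply: hF.
Qed.

End Intertwiners.

Lemma intertwinesV A n (rho1 rho2 : gT -> 'M[k]_n) f :
  f \in unitmx -> intertwines A rho1 rho2 f ->
  intertwines A rho2 rho1 (invmx f).
Proof.
move=> uf hf a Aa; apply: (canLR (mulKmx uf)).
by rewrite mulmxA hf // mulmxK.
Qed.

Lemma intertwines_scalar A n (rho : gT -> 'M[k]_n) c :
  intertwines A rho rho c%:M.
Proof. by move=> a _; rewrite scalar_mxC. Qed.

Lemma mx_rsimP G (M N : representation k G) : mx_rsim M N <->
  exists f g, [/\ intertwines G M N f, intertwines G N M g,
                  g *m f = 1%:M & f *m g = 1%:M].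
Proof.
(* The matrix in mx_rsim acts on row vectors; on columns it maps N to M. *)
split=> [/mx_rsim_sym | [f [g [hf hg gf fg]]]].
  case: M N => n1 rM [n2 rN] [/= B Dn]; subst n2; rewrite row_free_unit => uB hB.
  have hB': intertwines G rM rN B by move=> x Gx; rewrite hB.
  exists B, (invmx B).
  by split=> //; [apply: intertwinesV | rewrite mulVmx | rewrite mulmxV].
have rg: row_free g by apply/row_freeP; exists f.
have rf: row_free f by apply/row_freeP; exists g.
have En: rdegree M = rdegree N.
  have := rank_leq_col g; have := rank_leq_col f.
  rewrite (eqP rf) (eqP rg) => le1 le2.
  by apply/eqP; rewrite eqn_leq le1 le2.
by exists g => // x Gx; rewrite hg.
Qed.

Lemma complementary_orthogonal n p r (a : 'M[k]_(n, p)) (b : 'M_(p, n))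
    (c : 'M_(n, r)) (d : 'M_(r, n)) :
  b *m a = 1%:M -> d *m c = 1%:M -> a *m b + c *m d = 1%:M ->
  b *m c = 0 /\ d *m a = 0.
Proof.
move=> ba dc abcd; split.
  have: b *m (a *m b + c *m d) *m c = b *m c by rewrite abcd mulmx1.
  rewrite mulmxDr mulmxDl !mulmxA ba mul1mx -[_ *m d *m c]mulmxA dc mulmx1.
  by move/(canRL (addrK _)); rewrite subrr.
have: d *m (a *m b + c *m d) *m a = d *m a by rewrite abcd mulmx1.
rewrite mulmxDr mulmxDl !mulmxA dc mul1mx -[_ *m b *m a]mulmxA ba mulmx1.
by move/(canRL (addrK _)); rewrite subrr.
Qed.

Lemma rank_factorization m n (f : 'M[k]_(m, n)) :
  exists r (a : 'M_(m, r)) (b : 'M_(r, n)) a' b',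
    r = \rank f /\ [/\ a *m b = f, a' *m a = 1%:M & b *m b' = 1%:M].
Proof.
have [a' a'a] := row_fullP (col_base_full f).
have [b' bb'] := row_freeP (row_base_free f).
exists (\rank f), (col_base f), (row_base f), a', b'.
by do !split; rewrite ?mulmx_base.
Qed.

Lemma split_decomposition G (M L N : representation k G) a b c d :
  intertwines G L M a -> intertwines G M L b -> b *m a = 1%:M ->
  intertwines G N M c -> intertwines G M N d -> d *m c = 1%:M ->
  a *m b + c *m d = 1%:M -> mx_rsim M (dadd_grepr L N).
Proof.
move=> ha hb ba hc hd dc abcd.
have [bc da] := complementary_orthogonal ba dc abcd.
apply/mx_rsimP; exists (col_mx b d), (row_mx a c); split.
- by move=> x Gx; rewrite /= mul_col_mx mul_block_col !mul0mx addr0 add0r hb ?hd.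
- by move=> x Gx; rewrite /= mul_mx_row mul_row_block !mulmx0 addr0 add0r ha ?hc.
- by rewrite mul_row_col.
- by rewrite mul_col_row ba bc da dc -scalar_mx_block.
Qed.

Lemma dadd_decomposition G (M L N : representation k G) :
  mx_rsim M (dadd_grepr L N) ->
  exists a b c d, [/\ intertwines G L M a /\ intertwines G M L b,
    b *m a = 1%:M, intertwines G N M c /\ intertwines G M N d,
    d *m c = 1%:M & a *m b + c *m d = 1%:M].
Proof.
case/mx_rsimP=> f [g [hf hg gf fg]].
have ff: f = col_mx (usubmx f) (dsubmx f) by rewrite vsubmxK.
have gg: g = row_mx (lsubmx g) (rsubmx g) by rewrite hsubmxK.
have := fg; rewrite ff gg mul_col_row scalar_mx_block.
case/eq_block_mx=> E1 E2 E3 E4.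
have := gf; rewrite {1}gg {1}ff mul_row_col => E5.
have hf' x : x \in G -> usubmx f *m M x = L x *m usubmx f /\
                        dsubmx f *m M x = N x *m dsubmx f.
  move=> Gx; have := hf x Gx; rewrite {1 2}ff /= mul_col_mx mul_block_col.
  by rewrite !mul0mx addr0 add0r => /eq_col_mx.
have hg' x : x \in G -> lsubmx g *m L x = M x *m lsubmx g /\
                        rsubmx g *m N x = M x *m rsubmx g.
  move=> Gx; have := hg x Gx; rewrite {1 2}gg /= mul_mx_row mul_row_block.
  by rewrite !mulmx0 addr0 add0r => /eq_row_mx.
exists (lsubmx g), (usubmx f), (rsubmx g), (dsubmx f).
by split=> //; split=> x Gx; have [? ?] := hf' x Gx; have [? ?] := hg' x Gx.
Qed.

(** A rank factorisation of e provides coordinates on its image, and the action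
    is transported to them. *)
Lemma split_idempotent G (M : representation k G) e :
  intertwines G M M e -> e *m e = e ->
  exists (N : representation k G) c d,
    [/\ intertwines G N M c, intertwines G M N d, d *m c = 1%:M,
        c *m d = e & rdegree N = \rank e].
Proof.
move=> he ee.
have [r [c [d [c' [d' [Dr [cd c'c dd']]]]]]] := rank_factorization e.
have dc: d *m c = 1%:M.
  have cdcd: c *m d *m (c *m d) = c *m d by rewrite cd.
  have : c' *m (c *m d *m (c *m d)) *m d' = c' *m (c *m d) *m d' by rewrite cdcd.
  by rewrite -!mulmxA dd' !mulmx1 [c' *m (c *m _)]mulmxA c'c mul1mx.
have ec : e *m c = c by rewrite -cd -mulmxA dc mulmx1.
have de : d *m e = d by rewrite -cd mulmxA dc mul1mx.
pose rN (x : gT) := d *m M x *m c.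
have rNP: mx_repr G rN.
  split=> [|x y Gx Gy]; first by rewrite /rN repr_mx1 mulmx1.
  rewrite /rN repr_mxM // !mulmxA -[d *m M x *m c *m d]mulmxA cd.
  by rewrite -[d *m M x *m e]mulmxA -he // !mulmxA de.
exists (Representation (MxRepresentation rNP)), c, d; split=> //= x Gx.
  by rewrite /rN !mulmxA cd he // -mulmxA ec.
by rewrite /rN -!mulmxA cd -he // mulmxA de.
Qed.

Lemma intertwines_compl G (M : representation k G) e :
  intertwines G M M e -> intertwines G M M (1%:M - e).
Proof.
by move=> he; apply: intertwinesD; [apply: intertwines1 | apply: intertwinesN].
Qed.

Lemma compl_idempotent n (e : 'M[k]_n) :
  e *m e = e -> (1%:M - e) *m (1%:M - e) = 1%:M - e.
Proof. by move=> ee; rewrite mulmxBr mulmx1 mulmxBl mul1mx ee subrr subr0. Qed.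

Lemma split_complement G (L M : representation k G) a b :
  intertwines G L M a -> intertwines G M L b -> b *m a = 1%:M ->
  exists (N : representation k G) c d,
    [/\ intertwines G N M c, intertwines G M N d, d *m c = 1%:M
      & a *m b + c *m d = 1%:M].
Proof.
move=> ha hb ba; have he := intertwines_compl (intertwinesM hb ha).
have ee : a *m b *m (a *m b) = a *m b.
  by rewrite mulmxA -[a *m b *m a]mulmxA ba mulmx1.
have [N [c [d [hc hd dc cd _]]]] := split_idempotent he (compl_idempotent ee).
by exists N, c, d; split=> //; rewrite cd addrC subrK.
Qed.

Lemma componentP G (L M : representation k G) : component L M <->
  exists a b, [/\ intertwines G L M a, intertwines G M L b & b *m a = 1%:M].
Proof.
split=> [[N /dadd_decomposition[a [b [_ [_ [[ha hb] ba _ _ _]]]]]] | ].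
  by exists a, b.
case=> a [b [ha hb ba]].
have [N [c [d [hc hd dc abcd]]]] := split_complement ha hb ba.
by exists N; apply: split_decomposition ha hb ba hc hd dc abcd.
Qed.

Lemma indecomposable_idempotent G (M : representation k G) e :
  indecomposable M -> intertwines G M M e -> e *m e = e -> e = 0 \/ e = 1%:M.
Proof.
case=> _ indM he ee.
have [he' ee'] := (intertwines_compl he, compl_idempotent ee).
have [N1 [a [b [ha hb ba ab dN1]]]] := split_idempotent he ee.
have [N2 [c [d [hc hd dc cd dN2]]]] := split_idempotent he' ee'.
have: mx_rsim M (dadd_grepr N1 N2).
  by apply: (split_decomposition ha hb ba hc hd dc); rewrite ab cd addrC subrK.
case/indM; rewrite ?dN1 ?dN2 => /eqP; rewrite mxrank_eq0 => /eqP; first by left.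
by move/eqP; rewrite subr_eq0 => /eqP; right.
Qed.

Lemma component_indecomposable_rsim G (L M : representation k G) :
  indecomposable M -> (0 < rdegree L)%N -> component L M -> mx_rsim L M.
Proof.
move=> indM L_gt0 /componentP[a [b [ha hb ba]]].
have: a *m b *m (a *m b) = a *m b by rewrite mulmxA -[a *m b *m a]mulmxA ba mulmx1.
case/(indecomposable_idempotent indM (intertwinesM hb ha)) => ab; last first.
  by apply/mx_rsimP; exists a, b.
have := mxrank1 k (rdegree L); rewrite -ba -[b]mulmx1 -mulmxA.
have -> : b *m (1%:M *m a) = b *m (a *m b) *m a.
  by rewrite mul1mx mulmxA ba mul1mx ba.
by rewrite ab mulmx0 mul0mx mxrank0 => E; rewrite -E in L_gt0.
Qed.

End Components.

(** * The eigenvalue of an endomorphism of an indecomposable module *)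

Section EigenvalueIdempotent.

Variable k : fieldType.

Lemma singular_root n (phi : 'M[k]_n) c :
  (phi - c%:M \notin unitmx) = root (char_poly phi) c.
Proof.
by rewrite -eigenvalue_root_char /eigenvalue /eigenspace kermx_eq0 row_free_unit.
Qed.

(** The idempotent is the projection onto a generalised eigenspace, which is a
    polynomial in the matrix by the Bezout identity. *)
Lemma two_eigenvalues_idempotent n (phi : 'M[k]_n) a b :
  phi - a%:M \notin unitmx -> phi - b%:M \notin unitmx -> a != b ->
  exists e : 'M_n, [/\ e *m e = e, e != 0, e != 1%:M &
    forall psi, psi *m phi = phi *m psi -> psi *m e = e *m psi].
Proof.
case: n phi => [|n] phi; first by rewrite [phi - _]flatmx0 -(flatmx0 1%:M) unitmx1.
move=> sing_a sing_b ne_ab; set p := char_poly phi.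
have p_neq0 : p != 0 by rewrite monic_neq0 ?char_poly_monic.
have pa : root p a by rewrite -singular_root.
have pb : root p b by rewrite -singular_root.
have [m [q]] := multiplicity_XsubC p a.
rewrite p_neq0 /= => nqa Dp.
have m_gt0 : (0 < m)%N.
  by case: m Dp => // Dp; rewrite Dp expr0 mulr1 (negPf nqa) in pa.
have qb : root q b.
  move: pb; rewrite Dp rootM => /orP[//|].
  rewrite /root horner_exp !hornerE expf_eq0 m_gt0 /= subr_eq0 eq_sym.
  by rewrite (negPf ne_ab).
have /Bezout_eq1_coprimepP[[u v] /= Duv] : coprimep q (('X - a%:P) ^+ m).
  by rewrite coprimep_expr // coprimep_XsubC.
pose f := horner_mx phi (u * q); pose e := horner_mx phi (v * ('X - a%:P) ^+ m).
have fe1 : f + e = 1%:M by rewrite /f /e -rmorphD Duv rmorph1.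
have ef0 : e *m f = 0.
  rewrite -[_ *m _]/(e * f) -rmorphM /= mulrACA [_ ^+ m * q]mulrC -Dp.
  by rewrite rmorphM /= Cayley_Hamilton mulr0.
have De : e = 1%:M - f by rewrite -fe1 addrC addKr.
exists e; split.
- by rewrite {2}De mulmxBr mulmx1 ef0 subr0.
- apply: contraNneq sing_b => e0; move: fe1; rewrite e0 addr0.
  have [q' Dq'] := factor_theorem q b qb; rewrite /f Dq' mulrA rmorphM /=.
  by case/mulmx1_unit=> _; rewrite rmorphB /= horner_mx_X horner_mx_C.
- apply: contraNneq sing_a; rewrite /e -(prednK m_gt0) exprSr mulrA rmorphM /=.
  by case/mulmx1_unit=> _; rewrite rmorphB /= horner_mx_X horner_mx_C.
by move=> psi C; apply: comm_mx_horner.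
Qed.

End EigenvalueIdempotent.

Section Eigenvalue.

Variable k : closedFieldType.

(** Some root of the characteristic polynomial; for an endomorphism of an
    indecomposable module it is the only one, see eigval_unique. *)
Definition eigval n (phi : 'M[k]_n) : k :=
  head 0 (sval (closed_field_poly_normal (char_poly phi))).

Lemma eigval_singular n (phi : 'M[k]_n) :
  (0 < n)%N -> phi - (eigval phi)%:M \notin unitmx.
Proof.
move=> n_gt0; rewrite singular_root /eigval.
case: (closed_field_poly_normal _) => -[|a s] /= Dp.
  have := size_char_poly phi; rewrite Dp big_nil size_scale ?size_poly1.
    by move=> E; rewrite -(succn_inj E) in n_gt0.
  by rewrite lead_coef_eq0 monic_neq0 ?char_poly_monic.
rewrite Dp rootZ ?root_prod_XsubC ?mem_head //.
by rewrite lead_coef_eq0 monic_neq0 ?char_poly_monic.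
Qed.

Variables (gT : finGroupType) (G : {group gT}) (M : representation k G).
Hypothesis indM : indecomposable M.
Local Notation n := (rdegree M).
Local Notation endo := (intertwines G M M).
Implicit Types phi psi : 'M[k]_n.

(** Two eigenvalues would give a non-trivial idempotent endomorphism. *)
Lemma eigval_unique phi a :
  endo phi -> phi - a%:M \notin unitmx -> a = eigval phi.
Proof.
move=> hphi sing_a; apply/eqP/negP => /negP ne_a.
have sing := eigval_singular phi indM.1.
have [e [ee e0 e1 comm_e]] := two_eigenvalues_idempotent sing_a sing ne_a.
have he : endo e by move=> x Gx; rewrite comm_e // hphi.
by case: (indecomposable_idempotent indM he ee) => /eqP; apply/negP.
Qed.

Lemma eigval_scalar c : eigval (c%:M : 'M_n) = c.
Proof.
apply/esym/eigval_unique; first exact: intertwines_scalar.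
rewrite subrr; case: (n) indM.1 => // m _.
by rewrite unitmxE det0 unitr0.
Qed.

Lemma eigval1 : eigval (1%:M : 'M_n) = 1. Proof. exact: eigval_scalar. Qed.

Lemma eigval0 : eigval (0 : 'M_n) = 0.
Proof. by have := eigval_scalar 0; rewrite -scalemx1 scale0r. Qed.

Lemma eigval_eq0 phi : endo phi -> (eigval phi == 0) = (phi \notin unitmx).
Proof.
move=> hphi; apply/eqP/idP => [E0 | sing].
  by have := eigval_singular phi indM.1; rewrite E0 -scalemx1 scale0r subr0.
by apply/esym/eigval_unique; rewrite // -scalemx1 scale0r subr0.
Qed.

Lemma eigval_neq0 phi : endo phi -> (eigval phi != 0) = (phi \in unitmx).
Proof. by move/eigval_eq0->; rewrite negbK. Qed.

(** Two non-units summing to a unit u would make u^-1 phi an endomorphism with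
    the two eigenvalues 0 and 1. *)
Lemma singularD phi psi : endo phi -> endo psi ->
  phi \notin unitmx -> psi \notin unitmx -> phi + psi \notin unitmx.
Proof.
move=> hphi hpsi nphi npsi; apply/negP=> u_unit; set u := phi + psi in u_unit.
have hu : endo u by apply: intertwinesD.
pose phi' := invmx u *m phi.
have hphi' : endo phi' by apply: intertwinesM hphi (intertwinesV _ _).
have E0 : 0 = eigval phi'.
  apply: eigval_unique => //; rewrite -scalemx1 scale0r subr0.
  by rewrite unitmx_mul unitmx_inv u_unit.
have E1 : 1 = eigval phi'.
  apply: eigval_unique => //; rewrite -opprB -scaleN1r unitmxZ ?unitrN1 //.
  have -> : 1%:M - phi' = invmx u *m psi.
    by rewrite -[1%:M](mulVmx u_unit) -mulmxBr [u - phi]addrC addKr.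
  by rewrite unitmx_mul unitmx_inv u_unit.
by have := oner_neq0 k; rewrite E1 -E0 eqxx.
Qed.

Lemma eigvalD phi psi : endo phi -> endo psi ->
  eigval (phi + psi) = eigval phi + eigval psi.
Proof.
move=> hphi hpsi; apply/esym/eigval_unique; first exact: intertwinesD.
rewrite raddfD opprD addrACA /=.
by apply: singularD; rewrite ?eigval_singular ?indM.1 //;
   apply: intertwinesD => //; apply/intertwinesN/intertwines_scalar.
Qed.

Lemma eigvalZ c phi : endo phi -> eigval (c *: phi) = c * eigval phi.
Proof.
move=> hphi; have [-> | nz_c] := eqVneq c 0; first by rewrite scale0r mul0r eigval0.
apply/esym/eigval_unique; first exact: intertwinesZ.
rewrite -scale_scalar_mx -scalerBr unitmxZ ?unitfE //.
exact: eigval_singular indM.1.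
Qed.

Lemma eigval_sum I r (P : pred I) (F : I -> 'M_n) :
  (forall i, P i -> endo (F i)) ->
  eigval (\sum_(i <- r | P i) F i) = \sum_(i <- r | P i) eigval (F i).
Proof.
move=> hF; elim: r => [|i r IHr]; first by rewrite !big_nil eigval0.
rewrite !big_cons; case: ifP => // Pi; rewrite eigvalD ?IHr //.
  exact: hF.
exact: intertwines_sum.
Qed.

(** Non-units form a two-sided ideal, as a product of square matrices is
    singular once a factor is. *)
Lemma eigvalM phi psi : endo phi -> endo psi ->
  eigval (phi *m psi) = eigval phi * eigval psi.
Proof.
move=> hphi hpsi; set a := eigval phi; set b := eigval psi.
have h1 : endo ((phi - a%:M) *m psi).
  apply: intertwinesM hpsi (intertwinesD hphi _).
  exact/intertwinesN/intertwines_scalar.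
have -> : phi *m psi = (phi - a%:M) *m psi + a *: psi.
  by rewrite mulmxBl mul_scalar_mx subrK.
rewrite eigvalD //; last exact: intertwinesZ.
rewrite eigvalZ // -[RHS]add0r; congr (_ + _); apply/eqP.
by rewrite eigval_eq0 // unitmx_mul (negPf (eigval_singular _ indM.1)).
Qed.

(** If psi is invertible, the two products are conjugate; otherwise neither of
    them is invertible. The factors themselves need not be endomorphisms. *)
Lemma eigval_swap phi psi : endo (phi *m psi) -> endo (psi *m phi) ->
  eigval (phi *m psi) = eigval (psi *m phi).
Proof.
move=> h1 h2; have [u | nu] := boolP (psi \in unitmx); last first.
  transitivity (0 : k); [|symmetry]; apply/eqP;
  by rewrite eigval_eq0 // unitmx_mul (negPf nu) ?andbF.
apply: eigval_unique => //.
have := eigval_singular (phi *m psi) indM.1; set c := eigval _.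
suff -> : psi *m phi - c%:M = psi *m (phi *m psi - c%:M) *m invmx psi.
  by rewrite !unitmx_mul u unitmx_inv u andbT.
by rewrite mulmxBr mulmxBl !mulmxA mulmxK // scalar_mxC mulmxK.
Qed.

End Eigenvalue.

Lemma eigval_similar (k : closedFieldType) (gT : finGroupType)
    (G H : {group gT}) (M : representation k G) (N : representation k H)
    (phi : 'M_(rdegree M)) (psi : 'M_(rdegree N)) :
  indecomposable M -> indecomposable N ->
  intertwines G M M phi -> intertwines H N N psi ->
  (forall c, (phi - c%:M \in unitmx) = (psi - c%:M \in unitmx)) ->
  eigval phi = eigval psi.
Proof.
move=> indM indN hphi hpsi E; apply: eigval_unique => //.
by rewrite -E eigval_singular ?indM.1.
Qed.

Lemma eigval_adjoint (k : closedFieldType) (gT : finGroupType)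
    (G : {group gT}) (M : representation k G) (S phi : 'M_(rdegree M)) :
  indecomposable M -> S \in unitmx -> intertwines G M M phi ->
  intertwines G M M (invmx S *m phi^T *m S) ->
  eigval (invmx S *m phi^T *m S) = eigval phi.
Proof.
move=> indM uS h1 h2; apply: eigval_similar => // c.
suff -> : invmx S *m phi^T *m S - c%:M = invmx S *m (phi - c%:M)^T *m S.
  by rewrite !unitmx_mul unitmx_inv uS unitmx_tr andbT.
rewrite linearB /= tr_scalar_mx mulmxBr mulmxBl; congr (_ - _).
by rewrite scalar_mxC -mulmxA mulVmx ?mulmx1.
Qed.

(** * Relative traces *)

Section RelativeTrace.

Variables (k : fieldType) (gT : finGroupType) (G : {group gT}) (n1 n2 : nat).
Variables (rho1 : mx_representation k G n1) (rho2 : mx_representation k G n2).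
Implicit Types (H K W : {group gT}) (phi psi : 'M[k]_(n2, n1)).
Local Notation hom A := (intertwines A rho1 rho2).

Definition conj_mx psi (x : gT) : 'M_(n2, n1) := rho2 x^-1%g *m psi *m rho1 x.

(** Right cosets match the convention that groups act on the right. *)
Definition rel_trace (H K : {set gT}) psi : 'M_(n2, n1) :=
  \sum_(C in rcosets H K) conj_mx psi (repr C).

Lemma conj_mxM psi x y : x \in G -> y \in G ->
  conj_mx (conj_mx psi x) y = conj_mx psi (x * y)%g.
Proof.
by move=> Gx Gy; rewrite /conj_mx invMg !repr_mxM ?groupV // !mulmxA.
Qed.

Lemma conj_mxD phi psi x : conj_mx (phi + psi) x = conj_mx phi x + conj_mx psi x.
Proof. by rewrite /conj_mx mulmxDr mulmxDl. Qed.

Lemma conj_mx_sum I r (P : pred I) (F : I -> 'M_(n2, n1)) x :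
  conj_mx (\sum_(i <- r | P i) F i) x = \sum_(i <- r | P i) conj_mx (F i) x.
Proof. by rewrite /conj_mx mulmx_sumr mulmx_suml. Qed.

Lemma rel_traceD H K phi psi :
  rel_trace H K (phi + psi) = rel_trace H K phi + rel_trace H K psi.
Proof.
by rewrite /rel_trace -big_split; apply: eq_bigr => C _; rewrite conj_mxD.
Qed.

Lemma rel_traceZ H K c psi : rel_trace H K (c *: psi) = c *: rel_trace H K psi.
Proof.
rewrite /rel_trace scaler_sumr; apply: eq_bigr => C _.
by rewrite /conj_mx -scalemxAr -scalemxAl.
Qed.

Lemma rel_trace0 H K : rel_trace H K 0 = 0.
Proof. by have := rel_traceZ H K 0 0; rewrite !scale0r. Qed.

Lemma hom_conj K psi : K \subset G ->
  hom K psi <-> {in K, forall x, conj_mx psi x = psi}.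
Proof.
move/subsetP=> sKG; split=> E x Kx; have Gx := sKG x Kx.
  by rewrite /conj_mx -mulmxA E // mulmxA -repr_mxM ?groupV // mulVg repr_mx1 mul1mx.
by rewrite -{2}(E x Kx) /conj_mx !mulmxA -repr_mxM ?groupV // mulgV repr_mx1 mul1mx.
Qed.

Lemma rcosets_repr H K C : H \subset K -> C \in rcosets H K ->
  repr C \in K /\ C = (H :* repr C)%g.
Proof.
move=> sHK /rcosetsP[x Kx ->].
have xH := mem_repr_rcoset H x; split; last by apply/esym/rcoset_eqP.
by case/rcosetP: xH => h Hh ->; rewrite groupM // (subsetP sHK).
Qed.

Lemma group_in_rcosets H K : gval H \in rcosets H K.
Proof. by apply/rcosetsP; exists 1%g; rewrite ?rcoset1. Qed.

Lemma rcosets_repr_mem H K C : H \subset K -> C \in rcosets H K ->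
  (repr C \in H) = (C == H).
Proof.
move=> sHK /(rcosets_repr sHK)[_ DC]; rewrite {2}DC.
by apply/idP/eqP => [/rcoset_id // | <-]; apply: rcoset_refl.
Qed.

Lemma conj_mx_repr H psi x : H \subset G -> x \in G -> hom H psi ->
  conj_mx psi (repr (H :* x)%g) = conj_mx psi x.
Proof.
move=> sHG Gx hpsi; have /rcosetP[h Hh ->] := mem_repr_rcoset H x.
by rewrite -conj_mxM ?(subsetP sHG h) // (iffLR (hom_conj _ sHG) hpsi).
Qed.

Section Subgroups.

Variables H K : {group gT}.
Hypotheses (sHK : H \subset K) (sKG : K \subset G).
Let sHG := subset_trans sHK sKG.
Let memG x : x \in K -> x \in G. Proof. exact: (subsetP sKG). Qed.

Lemma reindex_rcosets (V : nmodType) (F : {set gT} -> V) x : x \in K ->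
  \sum_(C in rcosets H K) F C = \sum_(C in rcosets H K) F (C :* x)%g.
Proof.
move=> Kx; rewrite (reindex_inj (act_inj 'Rs%act x)); apply: eq_big => C.
  by rewrite (acts_act (actsRs_rcosets H K) Kx).
by rewrite /= rcosetE.
Qed.

Lemma rel_trace_hom psi : hom H psi -> hom K (rel_trace H K psi).
Proof.
move=> hpsi; apply/(hom_conj _ sKG) => x Kx; rewrite conj_mx_sum.
rewrite [RHS](reindex_rcosets _ Kx); apply: eq_bigr => C /(rcosets_repr sHK)[KC DC].
rewrite conj_mxM ?memG // {2}DC -rcosetM; apply/esym/conj_mx_repr => //.
by rewrite groupM ?memG.
Qed.

(** An element of the normaliser permutes the right cosets by multiplication on
    the left. *)
Lemma rel_trace_norm psi y : y \in K -> y \in 'N(H) -> hom H psi ->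
  rel_trace H K (conj_mx psi y) = rel_trace H K psi.
Proof.
move=> Ky Ny hpsi.
have lcosetH z x : z \in 'N(H) -> (z *: (H :* x) = H :* (z * x))%g.
  by move=> Nz; rewrite rcosetM (norm_rlcoset Nz) mulgA.
have memH z C : z \in K -> z \in 'N(H) -> C \in rcosets H K ->
    (z *: C)%g \in rcosets H K.
  move=> Kz Nz /(rcosets_repr sHK)[KC ->]; rewrite lcosetH //.
  by apply/rcosetsP; exists (z * repr C)%g; rewrite ?groupM.
rewrite [RHS]/rel_trace (reindex_inj (can_inj (lcosetK y))).
apply: eq_big => [C | C /(rcosets_repr sHK)[KC DC]].
  apply/idP/idP => [/memH-> // |].
  by move/(memH _ _ (groupVr Ky) (groupVr Ny)); rewrite lcosetK.
by rewrite conj_mxM ?memG // {2}DC lcosetH // conj_mx_repr // groupM ?memG.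
Qed.

End Subgroups.

(** Each coset of W lies in one coset of H. *)
Lemma rel_trace_trans W H K psi :
  W \subset H -> H \subset K -> K \subset G -> hom W psi ->
  rel_trace H K (rel_trace W H psi) = rel_trace W K psi.
Proof.
move=> sWH sHK sKG hpsi; have sWK := subset_trans sWH sHK.
have memG := subsetP sKG; have sHG := subset_trans sHK sKG.
have sWG := subset_trans sWH sHG.
have mulHW x : (H * (W :* x) = H :* x)%g by rewrite mulgA mulGSid.
rewrite [RHS]/rel_trace (partition_big (fun C => H * C)%g (mem (rcosets H K))).
  apply: eq_bigr => D /(rcosets_repr sHK)[KD DD].
  rewrite conj_mx_sum [RHS](reindex_inj (act_inj 'Rs%act (repr D))) /=.
  apply: eq_big => [C | C /(rcosets_repr sWH)[HC DC]]; rewrite rcosetE; last first.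
    have KC := subsetP sHK _ HC.
    by rewrite {2}DC -rcosetM conj_mx_repr ?conj_mxM ?groupM ?memG.
  apply/idP/andP=> [/(rcosets_repr sWH)[HC DC] | [/rcosetsP[y Ky Dy] /eqP HC]].
    have KC := subsetP sHK _ HC.
    split; first by apply/rcosetsP; exists (repr C * repr D)%g;
      rewrite ?groupM // rcosetM -DC.
    by rewrite DC -rcosetM mulHW rcosetM rcoset_id -?DD.
  have DC : C = (W :* (y * (repr D)^-1))%g by rewrite rcosetM -Dy rcosetK.
  apply/rcosetsP; exists (y * (repr D)^-1)%g => //.
  by rewrite -mem_rcoset -DD -HC Dy mulHW rcoset_refl.
move=> C /(rcosets_repr sWK)[KC ->]; rewrite mulHW.
by apply/rcosetsP; exists (repr C).
Qed.

End RelativeTrace.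

Section RelativeTraceComposition.

Variables (k : fieldType) (gT : finGroupType) (G H K : {group gT}).
Hypothesis sHK : H \subset K.
Variables (n1 n2 n3 : nat) (rho1 : mx_representation k G n1).
Variables (rho2 : mx_representation k G n2) (rho3 : mx_representation k G n3).

Lemma rel_traceMl phi psi : intertwines K rho2 rho3 phi ->
  rel_trace rho1 rho3 H K (phi *m psi) = phi *m rel_trace rho1 rho2 H K psi.
Proof.
move=> hphi; rewrite /rel_trace mulmx_sumr; apply: eq_bigr => C.
case/(rcosets_repr sHK) => KC _.
by rewrite /conj_mx !mulmxA hphi ?groupV.
Qed.

Lemma rel_traceMr phi psi : intertwines K rho1 rho2 phi ->
  rel_trace rho1 rho3 H K (psi *m phi) = rel_trace rho2 rho3 H K psi *m phi.
Proof.
move=> hphi; rewrite /rel_trace mulmx_suml; apply: eq_bigr => C.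
case/(rcosets_repr sHK) => KC _.
by rewrite /conj_mx -!mulmxA hphi.
Qed.

Lemma conj_mx_mul phi psi x : x \in G ->
  conj_mx rho1 rho3 (psi *m phi) x = conj_mx rho2 rho3 psi x *m conj_mx rho1 rho2 phi x.
Proof.
move=> Gx; rewrite /conj_mx !mulmxA; congr (_ *m _ *m _).
by rewrite -[RHS]mulmxA -repr_mxM ?groupV // mulgV repr_mx1 mulmx1.
Qed.

End RelativeTraceComposition.
Arguments rel_traceMl {k gT G H K} _ {n1 n2 n3 rho1 rho2 rho3} [phi] psi _.
Arguments rel_traceMr {k gT G H K} _ {n1 n2 n3 rho1 rho2 rho3} [phi] psi _.
Arguments conj_mx_mul {k gT G n1 n2 n3 rho1 rho2 rho3}.

(** * Induced modules and relative projectivity *)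

Section Induced.

Variables (k : fieldType) (gT : finGroupType) (G H : {group gT}).
Variables (sHG : H \subset G) (L : representation k H).
Local Notation X := (ind sHG L).

Lemma mulmx_cV_inj m n (A B : 'M[k]_(m, n)) :
  (forall v : 'cV_n, A *m v = B *m v) -> A = B.
Proof.
move=> E; apply/matrixP=> i j; have := E (delta_mx j 0).
by rewrite -!colE => /colP/(_ i); rewrite !mxE.
Qed.

Definition ind_in_at (x : gT) : 'M[k]_(rdegree X, rdegree L) :=
  \mxcol_i repr0 L ((coset_rep i)^-1 * x).
Definition ind_in := ind_in_at 1.
Definition ind_out : 'M[k]_(rdegree L, rdegree X) :=
  \mxrow_i repr0 L (coset_rep i).

Lemma ind_mul_in g x : x \in G -> X g *m ind_in_at x = ind_in_at (g * x).
Proof.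
move=> Gx; rewrite /ind_in_at /= mul_mxblock_mxrow; apply/eq_mxcolP => i.
by rewrite repr0_sum.
Qed.

Lemma ind_in_atM x h : h \in H -> ind_in_at (x * h) = ind_in_at x *m L h.
Proof.
by move=> Hh; rewrite mxcol_mul; apply/eq_mxcolP => i; rewrite mulgA repr0M.
Qed.

(** The translates of the inclusion of L span the induced module. *)
Lemma ind_ext m (A B : 'M[k]_(m, rdegree X)) :
  {in G, forall x, A *m ind_in_at x = B *m ind_in_at x} -> A = B.
Proof.
move=> E; apply: mulmx_cV_inj => u; rewrite (tens_sum u) !mulmx_sumr.
apply: eq_bigr => i _.
have -> : tens sHG (coset_rep i) (submxcol u i) =
          ind_in_at (coset_rep i) *m submxcol u i by rewrite mxcol_mul.
by rewrite !mulmxA E ?coset_rep_in.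
Qed.

Lemma ind_out_in_at x : x \in G -> ind_out *m ind_in_at x = repr0 L x.
Proof.
move=> Gx; rewrite mul_mxrow_mxcol; have [i _] := coset_rep_ex H Gx.
have := repr0_sum L i Gx (coset_rep i).
by rewrite mulKg => <-; apply: eq_bigr => j _; rewrite mulKg.
Qed.

Lemma ind_in_hom : intertwines H L X ind_in.
Proof. by move=> h Hh; rewrite ind_mul_in // mulg1 -ind_in_atM ?mul1g. Qed.

Lemma ind_out_hom : intertwines H X L ind_out.
Proof.
move=> h Hh; have Gh := subsetP sHG h Hh; apply: ind_ext => x Gx.
rewrite -!mulmxA ind_mul_in // !ind_out_in_at ?groupM // /repr0 groupMl //.
by case: ifP => Hx; rewrite ?mulmx0 ?repr_mxM.
Qed.

Lemma ind_out_in g : g \in G -> ind_out *m X g *m ind_in = repr0 L g.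
Proof. by move=> Gg; rewrite -mulmxA ind_mul_in // mulg1 ind_out_in_at. Qed.

(** The conjugates of the projection onto the block of H are the projections
    onto all the blocks. *)
Lemma ind_resolution : rel_trace X X H G (ind_in *m ind_out) = 1%:M.
Proof.
apply: ind_ext => x Gx; rewrite mul1mx /rel_trace mulmx_suml.
have xH : (H :* x^-1)%g \in rcosets H G.
  by apply/rcosetsP; exists x^-1%g; rewrite ?groupV.
have memr C : C \in rcosets H G -> (repr C * x \in H)%g = (C == H :* x^-1)%g.
  case/(rcosets_repr sHG) => GC DC; rewrite {2}DC.
  by rewrite -{1}[x]invgK -mem_rcoset; apply/idP/eqP=> /rcoset_eqP.
have term C : C \in rcosets H G ->
    conj_mx X X (ind_in *m ind_out) (repr C) *m ind_in_at x
      = ind_in_at (repr C)^-1 *m repr0 L (repr C * x).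
  case/(rcosets_repr sHG) => GC DC; rewrite /conj_mx -!mulmxA ind_mul_in //.
  by rewrite ind_out_in_at ?groupM // mulmxA ind_mul_in ?mulg1.
rewrite (big_only1 _ xH) => [|C /negPf nC xC]; last first.
  by rewrite term // /repr0 memr // nC mulmx0.
have Hx := memr _ xH; rewrite eqxx in Hx.
by rewrite term // /repr0 Hx -ind_in_atM // mulKg.
Qed.

(** What is used of an induced module: the inclusion j of L and the projection
    q onto L recover the action of H, kill the other cosets, and resolve the
    identity. *)
Definition induced_along (X : representation k G) (j : 'M[k]_(rdegree X, rdegree L))
    (q : 'M[k]_(rdegree L, rdegree X)) : Prop :=
  [/\ intertwines H L X j, intertwines H X L q,
      {in G, forall g, q *m X g *m j = repr0 L g}
    & rel_trace X X H G (j *m q) = 1%:M].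

Lemma ind_induced_along : @induced_along X ind_in ind_out.
Proof.
split; [exact: ind_in_hom | exact: ind_out_hom | exact: ind_out_in |].
exact: ind_resolution.
Qed.

End Induced.

Section Higman.

Variables (k : fieldType) (gT : finGroupType) (G : {group gT}).
Variable N : representation k G.

Lemma component_ind_trace (H : {group gT}) (sHG : H \subset G)
    (L : representation k H) a b :
  intertwines G N (ind sHG L) a -> intertwines G (ind sHG L) N b ->
  b *m a = 1%:M ->
  rel_trace N N H G (b *m ind_in sHG L *m (ind_out sHG L *m a)) = 1%:M.
Proof.
move=> ha hb ba; rewrite -mulmxA.
rewrite (rel_traceMl sHG _ hb) mulmxA.
by rewrite (rel_traceMr sHG _ ha) ind_resolution mul1mx.
Qed.

(** One half of Higman's criterion: compress the projection onto the block of L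
    to N. *)
Lemma relatively_projective_trace (H : {group gT}) :
  relatively_projective N H ->
  H \subset G /\ exists2 psi, intertwines H N N psi & rel_trace N N H G psi = 1%:M.
Proof.
case=> sHG [L /componentP[a [b [ha hb ba]]]]; split=> //.
exists (b *m ind_in sHG L *m (ind_out sHG L *m a)).
  apply: (intertwinesM (rho2 := L)); first apply: intertwinesM (ind_out_hom _ _).
    exact: intertwinesS ha.
  by apply: intertwinesM (ind_in_hom _ _) (intertwinesS sHG hb).
exact: component_ind_trace.
Qed.

(** The other half of Higman's criterion: N splits off the module induced from
    its own restriction, by the traces of j psi and of q. *)
Lemma trace_relatively_projective (H : {group gT}) (sHG : H \subset G) psi :
  intertwines H N N psi -> rel_trace N N H G psi = 1%:M ->
  relatively_projective N H.
Proof.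
move=> hpsi psi1; exists sHG, (res sHG N); apply/componentP.
set L := res sHG N; set X := ind sHG L.
pose j := ind_in sHG L; pose q := ind_out sHG L.
have hj : intertwines H N X j by exact: ind_in_hom.
have hq : intertwines H X N q by exact: ind_out_hom.
pose a := rel_trace N X H G (j *m psi); pose b := rel_trace X N H G q.
have ha : intertwines G N X a by apply: rel_trace_hom (intertwinesM hpsi hj).
have hb : intertwines G X N b by apply: rel_trace_hom hq.
exists a, b; split=> //.
rewrite -(rel_traceMr sHG _ ha) -psi1; congr (rel_trace _ _ _ _ _).
have HH := group_in_rcosets H G; have memr := rcosets_repr_mem sHG.
have term C : C \in rcosets H G ->
    q *m conj_mx N X (j *m psi) (repr C)
      = repr0 L (repr C)^-1 *m psi *m N (repr C).
  case/(rcosets_repr sHG) => GC DC.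
  by rewrite /conj_mx !mulmxA ind_out_in ?groupV.
(* The projection q picks out the term of the trivial coset. *)
rewrite /a /rel_trace mulmx_sumr (big_only1 _ HH) => [|C /negPf nC HC]; last first.
  by rewrite term // /repr0 groupV memr // nC !mul0mx.
have Hr : repr H \in H by rewrite memr.
rewrite term // /repr0 groupV Hr /=.
by apply: (iffLR (hom_conj _ _ _ sHG) hpsi).
Qed.

End Higman.

(** * Sums of equivariant families *)

Section EquivariantSums.

Variables (k : fieldType) (gT : finGroupType) (G V : {group gT}).
Hypothesis sVG : V \subset G.
Variables (n : nat) (rho : mx_representation k G n).
Local Notation endo A := (intertwines A rho rho).

(** Such a functional sees V-endomorphisms only modulo the traces from proper
    subgroups, as the Brauer construction does. *)
Definition kills_proper_traces (tau : 'M[k]_n -> k) : Prop :=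
  [/\ tau 0 = 0,
      forall phi psi, endo V phi -> endo V psi -> tau (phi + psi) = tau phi + tau psi
    & forall (W : {group gT}) psi, W \proper V -> endo W psi ->
        tau (rel_trace rho rho W V psi) = 0].

Variable tau : 'M[k]_n -> k.
Hypothesis tau_kills : kills_proper_traces tau.

Section Action.

Variables (T : finType) (to : {action gT &-> T}) (F : T -> 'M[k]_n).

Definition equivariant (S : {set T}) :=
  {in V & S, forall v t, F (to t v) = conj_mx rho rho (F t) v}.

(** The orbit corresponds to the cosets of the stabiliser of x. *)
Lemma orbit_sum_trace S x : equivariant S -> x \in S ->
  \sum_(t in orbit to V x) F t = rel_trace rho rho 'C_V[x | to] V (F x).
Proof.
move=> eqF Sx; have sVT : V \subset setT by apply: subsetT.
rewrite /rel_trace -(amove_orbit to x sVT) [RHS]big_imset /=; last first.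
  move=> y z Oy Oz E; have := amoveK sVT Oy; have := amoveK sVT Oz.
  by rewrite E /= => -> ->.
apply: eq_bigr => _ /orbitP[v Vv <-]; rewrite amove_act // conj_mx_repr //.
- by rewrite eqF.
- by rewrite subIset // sVG.
- exact: (subsetP sVG).
have sCG : 'C_V[x | to] \subset G by rewrite subIset // sVG.
apply/(hom_conj _ _ _ sCG) => c /setIP[Vc /astab1P Dc].
by rewrite -eqF // Dc.
Qed.

Lemma fixpoint_endo S x :
  equivariant S -> x \in S -> x \in 'Fix_to(V) -> endo V (F x).
Proof.
move=> eqF Sx /afixP fix_x; apply/(hom_conj _ _ _ sVG) => v Vv.
by rewrite -eqF // fix_x.
Qed.

Lemma equivariant_sum_endo S :
  [acts V, on S | to] -> equivariant S -> endo V (\sum_(t in S) F t).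
Proof.
move=> actS eqF; apply/(hom_conj _ _ _ sVG) => v Vv; rewrite conj_mx_sum.
rewrite [RHS](reindex_inj (act_inj to v)); apply: eq_big => [t | t St].
  by rewrite (acts_act actS Vv).
by rewrite eqF.
Qed.

(** The sum over a non-trivial orbit is a trace from a proper subgroup. *)
Lemma equivariant_sum S : [acts V, on S | to] -> equivariant S ->
  tau (\sum_(t in S) F t) = \sum_(t in S | t \in 'Fix_to(V)) tau (F t).
Proof.
case: tau_kills => tau0 tauD tau_tr.
have [m] := ubnP #|S|; elim: m S => // m IHm S; rewrite ltnS => leSm actS eqF.
have [-> | [x Sx]] := set_0Vmem S.
  by rewrite big_set0 tau0 big1 // => t; rewrite inE.
set O := orbit to V x.
have sOS : O \subset S by rewrite acts_sub_orbit.
have actO : [acts V, on O | to] by apply: acts_orbit; apply: subsetT.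
have actD : [acts V, on S :\: O | to] by apply: actsD.
have Ox : x \in O := orbit_refl to V x.
have sCV : 'C_V[x | to] \subset V := subsetIl _ _.
have sCG := subset_trans sCV sVG.
have hFx : endo 'C_V[x | to] (F x).
  apply/(hom_conj _ _ _ sCG) => c /setIP[Vc /astab1P Dc].
  by rewrite -eqF // Dc.
have sumS (R : nmodType) (f : T -> R) (P : pred T) :
    \sum_(t in S | P t) f t
     = \sum_(t in O | P t) f t + \sum_(t in S :\: O | P t) f t.
  rewrite (bigID (mem O)) /=; congr (_ + _); apply: eq_bigl => t.
    by case: (boolP (t \in O)) => [/(subsetP sOS)-> | _]; rewrite ?andbT ?andbF.
  by rewrite inE andbC andbA.
have eqD : equivariant (S :\: O) by move=> v t Vv /setDP[St _]; apply: eqF.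
have eqO : equivariant O by move=> v t Vv /(subsetP sOS)St; apply: eqF.
have -> : \sum_(t in S) F t = \sum_(t in O) F t + \sum_(t in S :\: O) F t.
  by rewrite (big_setID O) /= (setIidPr sOS).
rewrite tauD; try exact: equivariant_sum_endo.
rewrite sumS (IHm (S :\: O)) //; last first.
  apply: leq_trans leSm; apply: proper_card; rewrite properE subsetDl /=.
  by apply/subsetPn; exists x; rewrite // inE Ox.
congr (_ + _); have [fix_x | nfix_x] := boolP (x \in 'Fix_to(V)).
  have -> : O = [set x] by apply/orbit1P.
  rewrite big_set1 (big_pred1 x) // => t.
  by rewrite in_set1 /=; case: eqP => // ->.
rewrite (orbit_sum_trace eqF) // tau_tr //; last first.
  rewrite properE sCV /=; apply: contra nfix_x => /subsetP sVC.
  by apply/afixP => v /sVC/setIP[_ /astab1P].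
rewrite big1 // => t /andP[/orbitP[v Vv <-] fix_t]; case/negP: nfix_x.
have := afixP fix_t _ (groupVr Vv).
by rewrite actK => ->.
Qed.

End Action.

Section PairAction.

Variables (T : finType) (to : {action gT &-> T}).

Definition pair_to (p : T * T) (g : gT) := (to p.1 g, to p.2 g).

Lemma pair_to_is_action : is_action [set: gT] pair_to.
Proof.
split=> [g [s t] [s' t'] [/act_inj-> /act_inj->] // | p g h _ _].
by rewrite /pair_to !actM.
Qed.

Definition pair_action := Action pair_to_is_action.

(** On pairs of indices the swap commutes with the action, so that in
    characteristic two the fixed pairs off the diagonal cancel. *)
Lemma equivariant_sum_symmetric (S : {set T}) (F : T -> T -> 'M[k]_n)
    (adj : 'M[k]_n -> 'M[k]_n) :
  2%N \in [pchar k] -> [acts V, on S | to] ->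
  (forall phi, endo V phi -> tau (adj phi) = tau phi) ->
  {in S &, forall s t, F t s = adj (F s t)} ->
  {in S &, forall s t, {in V, forall v,
     F (to s v) (to t v) = conj_mx rho rho (F s t) v}} ->
  tau (\sum_(s in S) \sum_(t in S) F s t)
    = \sum_(s in S | s \in 'Fix_to(V)) tau (F s s).
Proof.
move=> char2 actS tau_adj symF eqF; pose F2 p := F p.1 p.2.
have eqF2 : equivariant pair_action F2 (setX S S).
  by move=> v [s t] Vv /setXP[Ss St]; apply: eqF.
have actS2 : [acts V, on setX S S | pair_action].
  apply/actsP=> v Vv [s t]; rewrite !in_setX /= /pair_to /=.
  by rewrite !(acts_act actS Vv).
have fixP s t : ((s, t) \in 'Fix_pair_action(V))
    = (s \in 'Fix_to(V)) && (t \in 'Fix_to(V)).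
  apply/afixP/andP=> [fix_st | [/afixP fix_s /afixP fix_t] v Vv].
    by split; apply/afixP=> v /fix_st[].
  by rewrite /= /pair_to /= fix_s ?fix_t.
have -> : \sum_(s in S) \sum_(t in S) F s t = \sum_(p in setX S S) F2 p.
  by rewrite pair_big /=; apply: eq_bigl => p; rewrite inE.
rewrite (equivariant_sum actS2 eqF2).
rewrite (@sum_involution _ char2 _ _ (fun p => (p.2, p.1))) /=; last 3 first.
- by case.
- by case=> s t; rewrite /= !in_setX !fixP [(t \in S) && _]andbC [(t \in 'Fix_to(V)) && _]andbC.
- case=> s t /andP[/setXP[Ss St] fix_st]; rewrite /F2 /= symF // tau_adj //.
  by apply: (fixpoint_endo (F := F2) eqF2 _ fix_st); apply/setXP.
rewrite (reindex_onto (fun s => (s, s)) (fun p => p.1)) /=; last first.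
  by case=> s t /andP[_ /eqP[->]].
by apply: eq_bigl => s; rewrite in_setX fixP !eqxx !andbb !andbT.
Qed.

End PairAction.
End EquivariantSums.

(** * Invariant forms as maps to the dual module *)

Section InvariantForms.

Variables (k : fieldType) (gT : finGroupType).

Lemma tr_bilinear m p n (D : 'M[k]_n) (f : 'M[k]_(n, m)) (g : 'M[k]_(n, p)) :
  D^T = D -> (f^T *m D *m g)^T = g^T *m D *m f.
Proof. by move=> symD; rewrite !trmx_mul trmxK symD mulmxA. Qed.

Lemma adjoint_compared n (S D : 'M[k]_n) : S^T = S -> S \in unitmx ->
  invmx S *m D^T = invmx S *m (invmx S *m D)^T *m S.
Proof. by move=> symS uS; rewrite trmx_mul trmx_inv symS -!mulmxA mulVmx // mulmx1. Qed.

Lemma dualE (G : {group gT}) (M : representation k G) x :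
  dual M x = (M x^-1%g)^T.
Proof. by []. Qed.

Lemma intertwines_tr (G1 G2 H : {group gT}) (M : representation k G1)
    (N : representation k G2) f :
  intertwines H M N f -> intertwines H (dual N) (dual M) f^T.
Proof.
by move=> hf x Hx; rewrite !dualE -!trmx_mul hf ?groupV.
Qed.

Variables (G1 G2 H : {group gT}) (M : representation k G1).
Variable N : representation k G2.

Lemma intertwines_pullback D f :
  intertwines H N (dual N) D -> intertwines H M N f ->
  intertwines H M (dual M) (f^T *m D *m f).
Proof.
move=> hD hf; rewrite -mulmxA.
exact: intertwinesM (intertwinesM hf hD) (intertwines_tr hf).
Qed.

Lemma intertwines_adjoint S D f :
  S \in unitmx -> intertwines H M (dual M) S -> intertwines H N (dual N) D ->
  intertwines H M N f -> intertwines H N M (invmx S *m f^T *m D).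
Proof.
move=> uS hS hD hf; rewrite -mulmxA.
apply: intertwinesM (intertwinesM hD (intertwines_tr hf)) _.
exact: intertwinesV.
Qed.

Lemma invariant_cancel D (x : gT) : H \subset G1 -> x \in H ->
  intertwines H M (dual M) D -> (M x)^T *m D *m M x = D.
Proof.
move=> sHG Hx hD; have Gx := subsetP sHG x Hx.
rewrite -mulmxA hD // dualE mulmxA -trmx_mul -repr_mxM ?groupV //.
by rewrite mulVg repr_mx1 trmx1 mul1mx.
Qed.

End InvariantForms.

Section TraceKilled.

Variables (k : closedFieldType) (gT : finGroupType) (G : {group gT}).
Variable M : representation k G.
Hypothesis indM : indecomposable M.

(** An invertible trace could be rescaled to 1, contrary to Higman's criterion. *)
Lemma eigval_rel_trace0 (W : {group gT}) psi :
  W \subset G -> ~ relatively_projective M W -> intertwines W M M psi ->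
  eigval (rel_trace M M W G psi) = 0.
Proof.
move=> sWG nproj hpsi; set u := rel_trace _ _ _ _ _.
have hu : intertwines G M M u by apply: rel_trace_hom.
apply/eqP; rewrite eigval_eq0 //; apply/negP=> uu; apply: nproj.
have hu' : intertwines G M M (invmx u) by apply: intertwinesV.
apply: (trace_relatively_projective sWG (psi := invmx u *m psi)).
  exact: intertwinesM hpsi (intertwinesS sWG hu').
by rewrite (rel_traceMl sWG _ hu') mulVmx.
Qed.

Lemma kills_proper_traces_eigval :
  (forall W : {group gT}, W \proper G -> ~ relatively_projective M W) ->
  kills_proper_traces G M (@eigval k (rdegree M)).
Proof.
move=> nproj; split; first exact: eigval0; first exact: eigvalD.
by move=> W psi pW hpsi; apply: eigval_rel_trace0 (nproj _ pW) hpsi; apply: proper_sub.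
Qed.

Lemma kills_proper_traces_trace (V : {group gT}) : V \subset G ->
  (forall W : {group gT}, W \proper V -> ~ relatively_projective M W) ->
  kills_proper_traces V M (fun psi => eigval (rel_trace M M V G psi)).
Proof.
move=> sVG nproj; split.
- by rewrite rel_trace0 eigval0.
- by move=> phi psi hphi hpsi; rewrite rel_traceD eigvalD //; apply: rel_trace_hom.
move=> W psi pW hpsi; have sWV := proper_sub pW.
rewrite rel_trace_trans //.
by apply: eigval_rel_trace0 (nproj _ pW) hpsi; apply: subset_trans sVG.
Qed.

End TraceKilled.

(** * The cosets fixed by V *)

Section FixedCosets.

Variables (gT : finGroupType) (G V : {group gT}).
Hypothesis sVG : V \subset G.

Lemma rcoset_fixed_mem (W : {group gT}) x y :
  ((W :* x) :* y = W :* x)%g -> (y ^ x^-1)%g \in W.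
Proof.
move=> E; have: (x * y)%g \in (W :* x :* y)%g by rewrite mem_rcoset mulgK rcoset_refl.
by rewrite E mem_rcoset conjgE invgK mulgA.
Qed.

(** The coset of x is fixed exactly when x normalises V. *)
Lemma fixed_rcosets (C : {set gT}) :
  (C \in rcosets V G) && (C \in 'Fix_('Rs)(V)) = (C \in rcosets V 'N_G(V)).
Proof.
apply/andP/rcosetsP=> [[/rcosetsP[x Gx ->] /afixP fixC] | [x /setIP[Gx Nx] ->]].
  exists x => //; rewrite inE Gx -[x]invgK groupV inE.
  apply/subsetP => y; rewrite mem_conjgV => /fixC /=; rewrite rcosetE.
  by move/rcoset_fixed_mem; rewrite conjgK.
split; first by apply/rcosetsP; exists x.
apply/afixP => v Vv; rewrite /= rcosetE -rcosetM; apply/rcoset_eqP.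
have -> : (x * v)%g \in (V :* x)%g = (v ^ x^-1 \in V)%g.
  by rewrite mem_rcoset conjgE invgK mulgA.
by rewrite memJ_norm ?groupV.
Qed.

(** Inversion turns right cosets into left cosets, and these agree in the
    normaliser. *)
Lemma sum_rcosets_norm_inv (R : nmodType) (f : gT -> R) :
  {in V & 'N_G(V), forall v x, f (v * x)%g = f x} ->
  \sum_(C in rcosets V 'N_G(V)) f (repr C)^-1%g
    = \sum_(C in rcosets V 'N_G(V)) f (repr C).
Proof.
move=> fV; have sVN : V \subset 'N_G(V) by rewrite subsetI sVG normG.
have inv_in C : C \in rcosets V 'N_G(V) -> (C^-1)%g \in rcosets V 'N_G(V).
  case/(rcosets_repr sVN) => NC ->; apply/rcosetsP; exists (repr C)^-1%g.
    by rewrite groupV.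
  by rewrite invMg invGid invg_set1 norm_rlcoset // groupV; case/setIP: NC.
rewrite [RHS](reindex_inj invg_inj); apply: eq_big => [C | C CN].
  by apply/idP/idP => /inv_in; rewrite ?invgK.
have [NC DC] := rcosets_repr sVN CN.
have [NC' DC'] := rcosets_repr sVN (inv_in C CN).
have /rcosetP[v Vv ->] : ((repr C)^-1 \in V :* repr (C^-1))%g.
  by rewrite -DC' inE invgK {2}DC rcoset_refl.
by rewrite fV.
Qed.

End FixedCosets.

(** * The dimension of a source *)

Section SourceRank.

Variables (k : closedFieldType) (gT : finGroupType) (G V : {group gT}).
Variables (sVG : V \subset G) (Z : representation k V) (N : representation k G).
Hypotheses (indZ : indecomposable Z) (indN : indecomposable N).
Hypothesis vertexN :
  forall W : {group gT}, W \proper V -> ~ relatively_projective N W.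
Variables (beta : 'M[k]_(rdegree Z, rdegree N)) (beta' : 'M[k]_(rdegree N, rdegree Z)).
Hypotheses (hbeta : intertwines V N Z beta) (hbeta' : intertwines V Z N beta').
Hypothesis beta1 : rel_trace N N V G (beta' *m beta) = 1%:M.

Definition trace_val (psi : 'M[k]_(rdegree N)) : k := eigval (rel_trace N N V G psi).
Local Notation tau := trace_val.

Let killN : kills_proper_traces V N tau := kills_proper_traces_trace indN sVG vertexN.

(** Multiply psi by the trace of beta' beta, which is 1, and by the trace of
    psi, and expand over pairs of cosets. Some fixed pair keeps a non-zero trace
    value, so by minimality the corresponding product, which passes from the
    image of psi through Z and back, loses no rank. Hence the image of psi is,
    up to conjugation, a non-zero summand of the indecomposable module Z. *)
Lemma source_rank_minimal psi : intertwines V N N psi -> tau psi != 0 ->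
  (forall phi, intertwines V N N phi -> tau phi != 0 -> (\rank psi <= \rank phi)%N) ->
  (rdegree Z <= \rank psi)%N.
Proof.
move=> hpsi nz_psi min_psi.
have memG := subsetP sVG.
have [r [a [b [a' [b' [Dr [ab a'a bb']]]]]]] := rank_factorization psi.
(* Y is the action of V on the image of psi, in the coordinates a. *)
have [Y aY] : exists Y, forall v, v \in V -> N v *m a = a *m Y v.
  exists (fun v => b *m N v *m b') => v Vv.
  by rewrite !mulmxA ab hpsi // -{1}ab -!mulmxA bb' mulmx1.
have Yb v : v \in V -> b *m N v = Y v *m b.
  move=> Vv; rewrite -[LHS]mul1mx -[RHS]mul1mx -a'a -!mulmxA; congr (_ *m _).
  by rewrite [RHS]mulmxA -aY // -mulmxA ab mulmxA ab hpsi.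
pose F C D := psi *m conj_mx N N (beta' *m beta) (repr C) *m conj_mx N N psi (repr D).
have htr := rel_trace_hom sVG (subxx G) hpsi.
have : tau (\sum_(p in setX (rcosets V G) (rcosets V G)) F p.1 p.2) != 0.
  have -> : \sum_(p in setX (rcosets V G) (rcosets V G)) F p.1 p.2
      = psi *m rel_trace N N V G psi.
    transitivity (\sum_(C in rcosets V G) \sum_(D in rcosets V G) F C D).
      by rewrite pair_big /=; apply: eq_bigl => p; rewrite inE.
    under eq_bigr do rewrite -mulmx_sumr.
    by rewrite -mulmx_suml -mulmx_sumr [X in psi *m X]beta1 mulmx1.
  rewrite /tau (rel_traceMr sVG _ htr) (eigvalM indN htr htr).
  exact: mulf_neq0.
have hbb : intertwines V N N (beta' *m beta) := intertwinesM hbeta hbeta'.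
have eqF : equivariant V N (pair_action 'Rs%act) (fun p => F p.1 p.2)
             (setX (rcosets V G) (rcosets V G)).
  move=> v [C D] Vv /setXP[CG DG] /=; have Gv := memG v Vv.
  have [GC DC] := rcosets_repr sVG CG; have [GD DD] := rcosets_repr sVG DG.
  rewrite /F /= !rcosetE {1}DC {1}DD -!rcosetM.
  rewrite !conj_mx_repr ?groupM // -!conj_mxM //.
  have psi_v : psi = conj_mx N N psi v by rewrite (iffLR (hom_conj _ _ _ sVG) hpsi).
  by rewrite {1}psi_v -!(conj_mx_mul (rho2 := N)).
have actS : [acts V, on rcosets V G | 'Rs] := subset_trans sVG (actsRs_rcosets V G).
have actS2 : [acts V, on setX (rcosets V G) (rcosets V G) | pair_action 'Rs].
  apply/actsP=> v Vv [C D]; rewrite !in_setX /= /pair_to /=.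
  by rewrite !(acts_act actS Vv).
rewrite (equivariant_sum sVG killN actS2 eqF) => nz_sum.
have [[C D] /= /andP[SCD fixCD] nzF] : exists2 p,
    (p \in setX (rcosets V G) (rcosets V G)) && (p \in 'Fix_(pair_action 'Rs)(V))
    & tau (F p.1 p.2) != 0.
  apply: NNPP => no; case/eqP: nz_sum; apply: big1 => p Sp.
  by apply/eqP/negPn/negP=> nz; apply: no; exists p.
have hF : intertwines V N N (F C D) := fixpoint_endo sVG eqF SCD fixCD.
have /setXP[CG DG] := SCD.
have [fixC fixD] : C \in 'Fix_('Rs)(V) /\ D \in 'Fix_('Rs)(V).
  by split; apply/afixP=> v /(afixP fixCD _)[].
have sVN : V \subset 'N_G(V) by rewrite subsetI sVG normG.
have NC : repr C \in 'N_G(V).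
  by apply: (rcosets_repr sVN _).1; rewrite -fixed_rcosets CG fixC.
have ND : repr D \in 'N_G(V).
  by apply: (rcosets_repr sVN _).1; rewrite -fixed_rcosets DG fixD.
have := min_psi _ hF nzF; rewrite /F -Dr.
move: (repr C) (repr D) NC ND => x y /setIP[Gx Nx] /setIP[Gy Ny] {hF nzF}.
(* f1 and f2 are linear over V up to conjugation by x y^-1 and by x. *)
pose f1 := beta *m N (x * y^-1)%g *m a; pose f2 := b *m N x^-1%g *m beta'.
set K := f2 *m f1.
have -> : psi *m conj_mx N N (beta' *m beta) x *m conj_mx N N psi y
    = a *m K *m (b *m N y).
  rewrite /conj_mx -{1 2}ab /K /f1 /f2 repr_mxM ?groupV //.
  by rewrite !mulmxA.
move=> le_rK; have uK : K \in unitmx.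
  rewrite -row_free_unit /row_free eqn_leq rank_leq_row (leq_trans le_rK) //.
  by rewrite (leq_trans (mxrankM_maxl _ _)) // mxrankM_maxr.
have conjN z v : z \in G -> v \in V -> N v *m N z = N z *m N (v ^ z)%g.
  move=> Gz Vv; have Gv := memG v Vv.
  by rewrite -!repr_mxM ?groupJ // -conjgC.
have Gt : (x * y^-1)%g \in G by rewrite groupM ?groupV.
have f1Z v : v \in V -> Z v *m f1 = f1 *m Y (v ^ (x * y^-1))%g.
  move=> Vv; have Vw : (v ^ (x * y^-1))%g \in V by rewrite memJ_norm ?groupM ?groupV.
  rewrite /f1 !mulmxA -hbeta // -(mulmxA beta (N v)) (conjN _ _ Gt Vv) !mulmxA.
  by rewrite -(mulmxA _ (N (v ^ _)%g) a) aY // !mulmxA.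
have f2Z v : v \in V -> f2 *m Z v = Y (v ^ x)%g *m f2.
  move=> Vv; have Vw : (v ^ x)%g \in V by rewrite memJ_norm.
  have Gx' : x^-1%g \in G by rewrite groupV.
  have := conjN _ _ Gx' Vw; rewrite conjgK => E.
  by rewrite /f2 -mulmxA hbeta' // !mulmxA -Yb // -(mulmxA b (N (v ^ x)%g)) E !mulmxA.
clearbody f1 f2.
have KY v : v \in V -> invmx K *m Y (v ^ x)%g = Y (v ^ (x * y^-1))%g *m invmx K.
  move=> Vv; apply: (canRL (mulmxK uK)); rewrite -mulmxA.
  apply: (canLR (mulKmx uK)).
  by rewrite /K mulmxA -f2Z // -!mulmxA f1Z.
(* s is the projection of Z onto the image of f1 along the kernel of f2. *)
pose s := f1 *m invmx K *m f2.
have hs : intertwines V Z Z s.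
  move=> v Vv; rewrite /s -(mulmxA _ f2 (Z v)) f2Z // !mulmxA f1Z //.
  by rewrite -(mulmxA f1 _ (Y (v ^ x)%g)) KY // !mulmxA.
have ss : s *m s = s.
  by rewrite /s !mulmxA -(mulmxA _ f2 f1) -/K mulmxKV.
have [s0 | s1] := indecomposable_idempotent indZ hs ss.
  have : K *m invmx K *m K = f2 *m s *m f1.
    by rewrite /s /K !mulmxA.
  rewrite s0 mulmx0 mul0mx mulmxV // mul1mx => K0.
  have rK : \rank K = r by apply/eqP; rewrite -[_ == _]/(row_free K) row_free_unit.
  have r0 : r = 0%N by rewrite -rK K0 mxrank0.
  case/eqP: nz_psi; have -> : psi = 0 by apply/eqP; rewrite -mxrank_eq0 -Dr r0.
  by case: killN.
rewrite -[rdegree Z](mxrank1 k) -s1 /s.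
by rewrite (leq_trans (mxrankM_maxr _ _)) // rank_leq_row.
Qed.

Lemma source_rank psi : intertwines V N N psi -> tau psi != 0 ->
  (rdegree Z <= \rank psi)%N.
Proof.
have [m] := ubnP (\rank psi); elim: m psi => // m IHm psi.
rewrite ltnS => le_psi hpsi nz.
have [[phi [hphi nz_phi lt_phi]] | no] := classic (exists phi,
    [/\ intertwines V N N phi, tau phi != 0 & (\rank phi < \rank psi)%N]).
  apply: leq_trans (ltnW lt_phi); apply: IHm hphi nz_phi.
  exact: leq_trans lt_phi le_psi.
apply: source_rank_minimal => // phi hphi nz_phi; rewrite leqNgt.
by apply/negP=> lt_phi; apply: no; exists phi.
Qed.

End SourceRank.

(** * The induced form *)

Section InducedForm.

Variables (k : fieldType) (gT : finGroupType) (G V : {group gT}).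
Variables (sVG : V \subset G) (Z : representation k V).
Variable A : 'M[k]_(rdegree Z).
Hypothesis symA : A^T = A.
Hypothesis invA : intertwines V Z (dual Z) A.

Variables (X : representation k G) (j : 'M[k]_(rdegree X, rdegree Z)).
Variable q : 'M[k]_(rdegree Z, rdegree X).
Hypothesis indX : induced_along j q.
Let hj : intertwines V Z X j. Proof. by case: indX. Qed.
Let hq : intertwines V X Z q. Proof. by case: indX. Qed.
Let qXj : {in G, forall g, q *m X g *m j = repr0 Z g}. Proof. by case: indX. Qed.

(** A form is a map to the dual module; the induced form is the trace of the
    form A extended by zero from the block of Z. *)
Definition ind_mx_form : 'M[k]_(rdegree X) :=
  rel_trace X (dual X) V G (q^T *m A *m q).
Notation B := ind_mx_form.

Let hqAq : intertwines V X (dual X) (q^T *m A *m q).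
Proof. exact: intertwines_pullback invA hq. Qed.

Lemma ind_mx_form_inv : intertwines G X (dual X) B.
Proof. exact: rel_trace_hom hqAq. Qed.

Lemma ind_mx_formE :
  B = \sum_(C in rcosets V G) (X (repr C))^T *m (q^T *m A *m q) *m X (repr C).
Proof. by apply: eq_bigr => C _; rewrite /conj_mx dualE invgK. Qed.

Lemma ind_mx_form_sym : B^T = B.
Proof.
rewrite ind_mx_formE raddf_sum; apply: eq_bigr => C _ /=.
by rewrite tr_bilinear // tr_bilinear.
Qed.

Lemma ind_mx_form_in : B *m j = q^T *m A.
Proof.
have VV := group_in_rcosets V G; have memr := rcosets_repr_mem sVG.
have term C : C \in rcosets V G ->
    (X (repr C))^T *m (q^T *m A *m q) *m X (repr C) *m j
    = (X (repr C))^T *m q^T *m A *m repr0 Z (repr C).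
  by case/(rcosets_repr sVG) => GC _; rewrite -(qXj GC);  rewrite !mulmxA.
rewrite ind_mx_formE mulmx_suml (big_only1 _ VV) => [|C /negPf nC VC]; last first.
  by rewrite term // /repr0 memr // nC mulmx0.
have Vr : repr V \in V by rewrite memr.
rewrite term // /repr0 Vr -trmx_mul hq // trmx_mul -!mulmxA.
by congr (_ *m _); rewrite mulmxA (invariant_cancel (subxx _) Vr invA).
Qed.

(** The last condition determines B, as the translates of j fill X. *)
Definition induced_form (B : 'M[k]_(rdegree X)) : Prop :=
  [/\ B^T = B, intertwines G X (dual X) B & B *m j = q^T *m A].

Lemma ind_mx_form_induced : induced_form ind_mx_form.
Proof.
by split; [exact: ind_mx_form_sym | exact: ind_mx_form_inv | exact: ind_mx_form_in].
Qed.

End InducedForm.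

(** * The norm character of the induced module *)

Section NormCharacter.

Variables (k : closedFieldType) (gT : finGroupType) (G V : {group gT}).
Variables (sVG : V \subset G) (Z : representation k V).
Hypothesis char2 : 2%N \in [pchar k].
Hypothesis indZ : indecomposable Z.
Hypothesis vertexZ :
  forall W : {group gT}, W \proper V -> ~ relatively_projective Z W.
Variable A : 'M[k]_(rdegree Z).
Hypotheses (symA : A^T = A) (uA : A \in unitmx).
Hypothesis invA : intertwines V Z (dual Z) A.
Variables (X : representation k G) (j : 'M[k]_(rdegree X, rdegree Z)).
Variable q : 'M[k]_(rdegree Z, rdegree X).
Hypothesis indX : induced_along j q.
Variable B : 'M[k]_(rdegree X).
Hypothesis indB : induced_form A j q B.

Let hj : intertwines V Z X j. Proof. by case: indX. Qed.
Let hq : intertwines V X Z q. Proof. by case: indX. Qed.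
Let qXj : {in G, forall g, q *m X g *m j = repr0 Z g}. Proof. by case: indX. Qed.
Let jq1 : rel_trace X X V G (j *m q) = 1%:M. Proof. by case: indX. Qed.
Let qj1 : q *m j = 1%:M.
Proof.
by rewrite -[q]mulmx1 -(repr_mx1 X) qXj // /repr0 group1 repr_mx1.
Qed.
Let symB : B^T = B. Proof. by case: indB. Qed.
Let invB : intertwines G X (dual X) B. Proof. by case: indB. Qed.
Let Bj : B *m j = q^T *m A. Proof. by case: indB. Qed.
Let invBV : intertwines V X (dual X) B. Proof. exact: intertwinesS sVG invB. Qed.

Lemma induced_form_out : j^T *m B = A *m q.
Proof.
by rewrite -[LHS]trmxK trmx_mul trmxK symB Bj trmx_mul trmxK symA.
Qed.

Lemma induced_form_unit : B \in unitmx.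
Proof.
pose Y := \sum_(C in rcosets V G)
  X (repr C)^-1%g *m j *m invmx A *m j^T *m (X (repr C)^-1%g)^T.
suff: B *m Y = 1%:M by case/mulmx1_unit.
rewrite -[1%:M]trmx1 -jq1 /rel_trace mulmx_sumr raddf_sum.
apply: eq_bigr => C /(rcosets_repr sVG)[GC _] /=.
rewrite /conj_mx !trmx_mul !mulmxA invB ?groupV // dualE invgK.
by rewrite -[_ *m B *m j]mulmxA Bj !mulmxA mulmxK.
Qed.

(** The eigenvalue measures the pullback of D to Z in units of A. *)
Definition form_norm (D : 'M[k]_(rdegree X)) (gam : 'M[k]_(rdegree X, rdegree Z)) : k :=
  eigval (invmx A *m (gam^T *m D *m gam)).

Definition norm_char (phi : 'M[k]_(rdegree X)) : k := form_norm B (phi *m j).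

Lemma invariant_endo D : intertwines V Z (dual Z) D ->
  intertwines V Z Z (invmx A *m D).
Proof. by move=> hD; apply: intertwinesM hD (intertwinesV uA invA). Qed.

Let killZ := kills_proper_traces_eigval indZ vertexZ.

Lemma eigval_form_tr D : intertwines V Z (dual Z) D -> intertwines V Z (dual Z) D^T ->
  eigval (invmx A *m D^T) = eigval (invmx A *m D).
Proof.
move=> hD hDt; have hE := invariant_endo hD; have hEt := invariant_endo hDt.
by rewrite (adjoint_compared _ symA uA) eigval_adjoint -?(adjoint_compared _ symA uA).
Qed.

Lemma form_endo D gam : intertwines V X (dual X) D -> intertwines V Z X gam ->
  intertwines V Z Z (invmx A *m (gam^T *m D *m gam)).
Proof. by move=> hD hg; apply/invariant_endo/intertwines_pullback. Qed.

(** The cross terms are transposes of each other, so they have the same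
    eigenvalue and cancel. *)
Lemma form_normD D gam del : D^T = D -> intertwines V X (dual X) D ->
  intertwines V Z X gam -> intertwines V Z X del ->
  form_norm D (gam + del) = form_norm D gam + form_norm D del.
Proof.
move=> symD hD hg hd; rewrite /form_norm.
have cross f g : intertwines V Z X f -> intertwines V Z X g ->
    intertwines V Z (dual Z) (f^T *m D *m g).
  move=> hf hg'; rewrite -mulmxA.
  by apply: intertwinesM (intertwinesM hg' hD) (intertwines_tr hf).
have Dcr := tr_bilinear gam del symD.
rewrite [(gam + del)^T]raddfD /= !mulmxDl !mulmxDr !eigvalD //;
  try by do ?[apply: intertwinesD | apply: invariant_endo | apply: cross].
rewrite -Dcr eigval_form_tr //; try (by rewrite ?Dcr; apply: cross).
by rewrite -!addrA; congr (_ + _); rewrite addrA addrr_pchar2 ?add0r.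
Qed.

(** Linearity over V up to conjugation: this is how a V-map from Z meets the
    block of an element that normalises V. *)
Definition twisted x (c : 'M[k]_(rdegree Z)) : Prop :=
  {in V, forall v, c *m Z v = Z (v ^ x^-1)%g *m c}.

Lemma twisted_pullback x c D : x \in 'N(V) -> twisted x c ->
  intertwines V Z (dual Z) D -> intertwines V Z (dual Z) (c^T *m D *m c).
Proof.
move=> Nx hc hD v Vv; rewrite dualE -!mulmxA hc //.
have Vvx : (v ^ x^-1)%g \in V by rewrite memJ_norm ?groupV.
rewrite [D *m _]mulmxA hD // dualE -[((v ^ x^-1)^-1)%g]conjVg !mulmxA -!trmx_mul.
by rewrite hc ?groupV.
Qed.

Lemma invariant_decomposition D : intertwines V Z (dual Z) D ->
  exists D0, [/\ intertwines V Z (dual Z) D0, D0 \notin unitmx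
               & D = eigval (invmx A *m D) *: A + D0].
Proof.
move=> hD; set a := eigval _; pose D0 := D - a *: A.
have hD0 : intertwines V Z (dual Z) D0.
  by apply: intertwinesD hD _; apply/intertwinesN/intertwinesZ.
exists D0; split=> //; last by rewrite /D0 addrC subrK.
have : invmx A *m D0 \notin unitmx.
  rewrite -(eigval_eq0 indZ (invariant_endo hD0)).
  rewrite /D0 mulmxBr -scalemxAr mulVmx // scalemx1 -raddfN.
  rewrite (eigvalD indZ (invariant_endo hD) (@intertwines_scalar _ _ _ _ _ _)).
  by rewrite (eigval_scalar indZ) subrr.
by rewrite unitmx_mul unitmx_inv uA.
Qed.

(** Once D is written as a multiple of A plus a non-invertible form, the second
    summand stays non-invertible after pulling back. *)
Lemma twisted_norm x c D : x \in 'N(V) -> twisted x c ->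
  intertwines V Z (dual Z) D ->
  eigval (invmx A *m (c^T *m D *m c))
    = eigval (invmx A *m D) * eigval (invmx A *m (c^T *m A *m c)).
Proof.
move=> Nx hc hD; have [D0 [hD0 nD0]] := invariant_decomposition hD.
move: (eigval (invmx A *m D)) => a DD; rewrite {1}DD.
rewrite mulmxDr mulmxDl mulmxDr -scalemxAr -scalemxAl -scalemxAr.
have h1 := invariant_endo (twisted_pullback Nx hc invA).
have h2 := invariant_endo (twisted_pullback Nx hc hD0).
rewrite (eigvalD indZ (intertwinesZ a h1) h2) (eigvalZ indZ a h1).
suff -> : eigval (invmx A *m (c^T *m D0 *m c)) = 0 by rewrite addr0.
by apply/eqP; rewrite (eigval_eq0 indZ h2) !unitmx_mul (negPf nD0) !(andbF, andFb).
Qed.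

Lemma twisted_adjoint_endo x c : x \in 'N(V) -> twisted x c ->
  intertwines V Z Z (c *m (invmx A *m c^T *m A)).
Proof.
move=> Nx hc w Vw; pose v := (w ^ x)%g.
have Vv : v \in V by rewrite memJ_norm.
have Dw : w = (v ^ x^-1)%g by rewrite conjgK.
have hA' : invmx A *m c^T *m A *m Z w = Z v *m (invmx A *m c^T *m A).
  rewrite -!mulmxA invA // dualE [c^T *m _]mulmxA -trmx_mul Dw -conjVg.
  rewrite -hc ?groupV // trmx_mul -mulmxA -dualE !mulmxA.
  by rewrite (intertwinesV uA invA).
by rewrite -[LHS]mulmxA hA' !mulmxA hc // -Dw.
Qed.

Lemma twisted_component x phi gam : x \in G -> x \in 'N(V) ->
  intertwines G X X phi -> intertwines V Z X gam ->
  twisted x (q *m X x *m (phi *m gam)).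
Proof.
move=> Gx Nx hphi hg v Vv; have Gv := subsetP sVG v Vv.
have Vvx : (v ^ x^-1)%g \in V by rewrite memJ_norm ?groupV.
have Gvx := subsetP sVG _ Vvx.
have hpg : intertwines V Z X (phi *m gam) := intertwinesM hg (intertwinesS sVG hphi).
rewrite -[LHS]mulmxA hpg // !mulmxA -hq //.
rewrite -[q *m X x *m X v]mulmxA -[q *m X _ *m X x]mulmxA -!repr_mxM //.
by rewrite -conjgCV.
Qed.

(** In the group algebra picture, the square of the coefficient of gam at x. *)
Definition twisted_coef gam x : k :=
  eigval (invmx A *m ((q *m X x *m gam)^T *m A *m (q *m X x *m gam))).

Lemma twisted_coefM gam v x : v \in V -> x \in G ->
  twisted_coef gam (v * x) = twisted_coef gam x.
Proof.
move=> Vv Gx; have Gv := subsetP sVG v Vv.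
have E : q *m X (v * x)%g *m gam = Z v *m (q *m X x *m gam).
  by rewrite repr_mxM // [q *m _]mulmxA hq // !mulmxA.
rewrite /twisted_coef E; set c := q *m X x *m gam.
congr (eigval (_ *m _)); rewrite trmx_mul -!mulmxA; congr (_ *m _).
by rewrite 2!mulmxA (invariant_cancel (subxx _) Vv invA).
Qed.

(** Decompose gam along the blocks of the induced module: V permutes the pairs
    of blocks, the terms at two blocks are adjoint when the blocks are
    swapped, and the blocks fixed by V are those of the normaliser. *)
Lemma form_norm_expansion D gam : D^T = D -> intertwines G X (dual X) D ->
  intertwines V Z X gam ->
  form_norm D gam = form_norm D j *
    \sum_(C in rcosets V 'N_G(V)) twisted_coef gam (repr C).
Proof.
move=> symD hD hg; have hDV := intertwinesS sVG hD.
pose p C := conj_mx X X (j *m q) (repr C).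
have hjq : intertwines V X X (j *m q) := intertwinesM hq hj.
have Dgam : gam = \sum_(C in rcosets V G) p C *m gam.
  have p1 : \sum_(C in rcosets V G) p C = 1%:M by exact: jq1.
  by rewrite -mulmx_suml p1 mul1mx.
pose F C1 C2 := invmx A *m ((p C1 *m gam)^T *m D *m (p C2 *m gam)).
have expand (S : {set {set gT}}) (u : {set gT} -> 'M[k]_(rdegree X, rdegree Z)) :
    invmx A *m ((\sum_(C in S) u C)^T *m D *m (\sum_(C in S) u C))
    = \sum_(C1 in S) \sum_(C2 in S) invmx A *m ((u C1)^T *m D *m u C2).
  rewrite [(\sum_(C in S) u C)^T]raddf_sum !mulmx_suml mulmx_sumr.
  by apply: eq_bigr => C1 _; rewrite !mulmx_sumr.
have -> : form_norm D gam
    = eigval (\sum_(C1 in rcosets V G) \sum_(C2 in rcosets V G) F C1 C2).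
  by rewrite /F -expand -Dgam.
have memG := subsetP sVG.
have pM C v : C \in rcosets V G -> v \in V ->
    p ('Rs%act C v) *m gam = X v^-1%g *m (p C *m gam) *m Z v.
  case/(rcosets_repr sVG) => GC DC Vv; rewrite /p /= rcosetE {1}DC -rcosetM.
  have Gv := memG v Vv.
  rewrite conj_mx_repr ?groupM // -conj_mxM // {1}/conj_mx.
  by rewrite -!mulmxA hg.
rewrite (equivariant_sum_symmetric (subxx V) killZ (to := 'Rs%act)
  (adj := fun phi => invmx A *m phi^T *m A) char2); last first.
- move=> C1 C2 C1G C2G v Vv; rewrite /F !pM // /conj_mx !trmx_mul.
  have -> : (X v^-1%g)^T = dual X v by [].
  rewrite !mulmxA; congr (_ *m _).
  rewrite -[_ *m dual X v *m D]mulmxA -hDV // !mulmxA.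
  rewrite -[_ *m X v *m X v^-1%g]mulmxA -repr_mxM ?groupV ?memG // mulgV repr_mx1 mulmx1.
  have -> : invmx A *m (Z v)^T = Z v^-1%g *m invmx A.
    rewrite -[v]invgK -dualE invgK.
    by rewrite (intertwinesV uA invA) // groupV.
  by [].
- move=> C1 C2 C1G C2G; by rewrite /F -(adjoint_compared _ symA uA) tr_bilinear.
- move=> phi hphi; apply: eigval_adjoint => //.
  exact: intertwines_adjoint uA invA invA hphi.
- exact: subset_trans sVG (actsRs_rcosets V G).
rewrite (eq_bigl _ _ (fixed_rcosets G V)).
rewrite mulr_sumr; apply: eq_bigr => C /(rcosets_repr _)[|NC _].
  by rewrite subsetI sVG normG.
have /setIP[GC NV] := NC.
rewrite /F /p /conj_mx; set x := repr C in GC NV *.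
pose c := q *m X x *m gam.
have -> : X x^-1%g *m (j *m q) *m X x *m gam = X x^-1%g *m j *m c.
  by rewrite /c !mulmxA.
have hc : twisted x c.
  have := twisted_component GC NV (@intertwines1 _ _ G _ X) hg.
  by rewrite /twisted /c mul1mx.
rewrite /twisted_coef -/c; move: c hc => c hc.
have -> : (X x^-1%g *m j *m c)^T *m D *m (X x^-1%g *m j *m c)
          = c^T *m (j^T *m D *m j) *m c.
  rewrite !trmx_mul -!mulmxA; congr (_ *m (_ *m _)); rewrite !mulmxA.
  by rewrite (invariant_cancel (subxx G) _ hD) ?groupV.
rewrite (twisted_norm NV hc) //.
exact: intertwines_pullback hDV hj.
Qed.

Lemma form_norm_in : form_norm B j = 1.
Proof.
rewrite /form_norm -mulmxA Bj mulmxA -trmx_mul qj1 trmx1.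
by rewrite mul1mx mulVmx // eigval1.
Qed.

Lemma form_norm_coef gam : intertwines V Z X gam ->
  form_norm B gam = \sum_(C in rcosets V 'N_G(V)) twisted_coef gam (repr C).
Proof.
move=> hg; rewrite (form_norm_expansion symB invB hg).
by rewrite form_norm_in mul1r.
Qed.

Lemma form_norm_mul D gam : D^T = D -> intertwines G X (dual X) D ->
  intertwines V Z X gam -> form_norm D gam = form_norm D j * form_norm B gam.
Proof. by move=> symD hD hg; rewrite form_norm_coef // -form_norm_expansion. Qed.

Let homj phi : intertwines G X X phi -> intertwines V Z X (phi *m j).
Proof. by move=> hphi; apply: intertwinesM hj (intertwinesS sVG hphi). Qed.

(** The endomorphism phi is moved from the map to the form, which becomes the
    pullback of B along phi. *)
Lemma form_norm_endo phi gam : intertwines G X X phi -> intertwines V Z X gam ->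
  form_norm B (phi *m gam) = norm_char phi * form_norm B gam.
Proof.
move=> hphi hg; have -> : form_norm B (phi *m gam) = form_norm (phi^T *m B *m phi) gam.
  by rewrite /form_norm trmx_mul !mulmxA.
rewrite (form_norm_mul (tr_bilinear phi phi symB) (intertwines_pullback invB hphi) hg).
suff -> : form_norm (phi^T *m B *m phi) j = norm_char phi by [].
by rewrite /norm_char /form_norm trmx_mul !mulmxA.
Qed.

Lemma norm_charM phi psi : intertwines G X X phi -> intertwines G X X psi ->
  norm_char (phi *m psi) = norm_char phi * norm_char psi.
Proof.
move=> hphi hpsi; rewrite /norm_char -mulmxA.
exact: form_norm_endo hphi (homj hpsi).
Qed.

Lemma norm_charD phi psi : intertwines G X X phi -> intertwines G X X psi ->
  norm_char (phi + psi) = norm_char phi + norm_char psi.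
Proof.
move=> hphi hpsi; rewrite /norm_char mulmxDl.
exact: form_normD symB invBV (homj hphi) (homj hpsi).
Qed.

Lemma norm_char1 : norm_char 1%:M = 1.
Proof. by rewrite /norm_char mul1mx form_norm_in. Qed.

Lemma norm_charZ c phi : intertwines G X X phi ->
  norm_char (c *: phi) = c ^+ 2 * norm_char phi.
Proof.
move=> hphi; have hE := form_endo invBV (homj hphi).
rewrite /norm_char /form_norm -scalemxAl [(c *: (phi *m j))^T]linearZ /= -!scalemxAl -!scalemxAr.
by rewrite scalerA (eigvalZ indZ _ hE) expr2.
Qed.

Lemma norm_char0 : norm_char 0 = 0.
Proof. by rewrite /norm_char /form_norm mul0mx trmx0 !mul0mx mulmx0 eigval0. Qed.

(** The component at x of the adjoint of phi is the adjoint of the component of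
    phi at x^-1. *)
Lemma norm_char_adjoint phi : intertwines G X X phi ->
  norm_char (invmx B *m phi^T *m B) = norm_char phi.
Proof.
move=> hphi; set phi' := _ *m B.
have hphi' : intertwines G X X phi'.
  exact: intertwines_adjoint induced_form_unit invB invB hphi.
rewrite /norm_char (form_norm_coef (homj hphi')) (form_norm_coef (homj hphi)).
rewrite -[RHS](sum_rcosets_norm_inv sVG (f := twisted_coef (phi *m j))); last first.
  by move=> v x Vv /setIP[Gx _]; apply: twisted_coefM.
apply: eq_bigr => C /(rcosets_repr _)[|NC _].
  by rewrite subsetI sVG normG.
have /setIP[GC NV] := NC; set x := repr C in GC NV *.
rewrite /twisted_coef; set c := q *m X x^-1%g *m (phi *m j).
have -> : q *m X x *m (phi' *m j) = invmx A *m c^T *m A.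
  have Dq : q = invmx A *m (j^T *m B) by rewrite induced_form_out mulKmx.
  have -> : phi' *m j = invmx B *m (phi^T *m (q^T *m A)).
    by rewrite /phi' -!mulmxA Bj.
  rewrite {1}Dq -!mulmxA [B *m (X x *m _)]mulmxA invB // -!mulmxA.
  rewrite mulKVmx ?induced_form_unit // dualE.
  rewrite /c -[q *m X _ *m _]mulmxA [X _ *m _]mulmxA -hphi ?groupV //.
  by rewrite !trmx_mul !mulmxA.
have NVx : x^-1%g \in 'N(V) by rewrite groupV.
have hc : twisted x^-1%g c by apply: twisted_component; rewrite ?groupV.
move: c hc => c hc; have h1 := twisted_adjoint_endo NVx hc.
have h2 : intertwines V Z Z (invmx A *m c^T *m A *m c).
  by have := invariant_endo (twisted_pullback NVx hc invA); rewrite !mulmxA.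
have -> : invmx A *m ((invmx A *m c^T *m A)^T *m A *m (invmx A *m c^T *m A))
          = c *m (invmx A *m c^T *m A).
  rewrite !trmx_mul trmxK trmx_inv symA -!mulmxA mulKmx //.
  by rewrite [A *m (invmx A *m _)]mulKVmx.
by rewrite (eigval_swap indZ h1 h2) -!mulmxA.
Qed.

(** A module is distinguished when it is split off X by an idempotent on which
    the norm character does not vanish. *)
Definition distinguished (N : representation k G) : Prop :=
  exists a b, [/\ intertwines G N X a, intertwines G X N b, b *m a = 1%:M
                & norm_char (a *m b) != 0].

Section Split.

Variables (N : representation k G) (a : 'M[k]_(rdegree X, rdegree N)).
Variable b : 'M[k]_(rdegree N, rdegree X).
Hypotheses (ha : intertwines G N X a) (hb : intertwines G X N b).
Hypotheses (ba : b *m a = 1%:M) (nz_ab : norm_char (a *m b) != 0).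

Let hasb s : intertwines G N N s -> intertwines G X X (a *m s *m b).
Proof. by move=> hs; apply: intertwinesM hb (intertwinesM hs ha). Qed.

Let hab : intertwines G X X (a *m b) := intertwinesM hb ha.

Let asbM s t : a *m s *m b *m (a *m t *m b) = a *m (s *m t) *m b.
Proof. by rewrite !mulmxA -[_ *m b *m a]mulmxA ba mulmx1. Qed.

Lemma norm_char_split : norm_char (a *m b) = 1.
Proof.
apply: (mulfI nz_ab); rewrite mulr1 -(norm_charM hab hab).
by rewrite mulmxA -[_ *m b *m a]mulmxA ba mulmx1.
Qed.

(** On the endomorphisms of N the norm character is multiplicative and
    Frobenius-semilinear: subtracting a square root of its value at s gives a
    zero of it, which cannot be invertible. *)
Lemma norm_char_unit s : indecomposable N -> intertwines G N N s ->
  norm_char (a *m s *m b) != 0 -> s \in unitmx.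
Proof.
move=> indN hs nz; apply: contraNT nz => ns; set c := norm_char _.
have /closed_rootP[d] : size ('X^2 - c%:P) != 1%N by rewrite size_XnsubC.
rewrite rootE !hornerE subr_eq0 => /eqP Dc.
have [// | nz_c] := eqVneq c 0.
have nz_d : d != 0 by apply: contraNneq nz_c => d0; rewrite -Dc d0 expr0n.
pose t := s - d%:M.
have hd : intertwines G N N d%:M by exact: intertwines_scalar.
have ht : intertwines G N N t := intertwinesD hs (intertwinesN hd).
have ut : t \in unitmx.
  rewrite -(eigval_neq0 indN ht) (eigvalD indN hs (intertwinesN hd)).
  move: ns; rewrite -(eigval_eq0 indN hs) => /eqP ->.
  by rewrite -raddfN (eigval_scalar indN) add0r oppr_eq0.
have t0 : norm_char (a *m t *m b) = 0.
  have -> : a *m t *m b = a *m s *m b + (- d) *: (a *m b).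
    by rewrite /t mulmxBr mulmxBl mul_mx_scalar scaleNr -scalemxAl.
  have hdab : intertwines G X X ((- d) *: (a *m b)) by exact: intertwinesZ.
  rewrite (norm_charD (hasb hs) hdab) (norm_charZ _ hab) norm_char_split mulr1.
  by rewrite sqrrN Dc -/c addrr_pchar2.
have ht' := intertwinesV ut ht.
have := norm_charM (hasb ht) (hasb ht'); rewrite t0 mul0r asbM mulmxV // mulmx1.
by rewrite norm_char_split => /eqP; rewrite oner_eq0.
Qed.

End Split.

Lemma distinguished_rsim (M N : representation k G) :
  mx_rsim N M -> distinguished M -> distinguished N.
Proof.
case/mx_rsimP=> f [g [hf hg gf fg]] [a [b [ha hb ba nz_ab]]].
exists (a *m f), (g *m b); split.
- exact: intertwinesM hf ha.
- exact: intertwinesM hb hg.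
- by rewrite mulmxA -[g *m b *m a]mulmxA ba mulmx1 gf.
- by rewrite mulmxA -[a *m f *m g]mulmxA fg mulmx1.
Qed.

(** For projections e onto M and f onto N the norm of e f e is not zero, so the
    composite from M to N and back is invertible. *)
Lemma distinguished_unique (M N : representation k G) :
  indecomposable M -> indecomposable N -> distinguished M -> distinguished N ->
  mx_rsim M N.
Proof.
move=> indM indN [a [b [ha hb ba nz_ab]]] [c [d [hc hd dc nz_cd]]].
have hab := intertwinesM hb ha; have hcd := intertwinesM hd hc.
pose s := b *m c *m (d *m a).
have hda : intertwines G M N (d *m a) := intertwinesM ha hd.
have hs : intertwines G M M s := intertwinesM hda (intertwinesM hc hb).
have us : s \in unitmx.
  apply: (norm_char_unit ha hb ba nz_ab indM hs).
  have -> : a *m s *m b = a *m b *m (c *m d) *m (a *m b) by rewrite /s !mulmxA.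
  rewrite (norm_charM (intertwinesM hcd hab) hab) (norm_charM hab hcd).
  exact: mulf_neq0 (mulf_neq0 nz_ab nz_cd) nz_ab.
apply: component_indecomposable_rsim indN indM.1 _; apply/componentP.
exists (d *m a), (invmx s *m (b *m c)); split=> //.
  exact: intertwinesM (intertwinesM hc hb) (intertwinesV us hs).
by rewrite -mulmxA mulVmx.
Qed.

(** The norm is additive, so one of the summands in a decomposition of a
    distinguished module is distinguished; X itself is. *)
Lemma distinguished_indecomposable :
  exists2 M : representation k G, indecomposable M & distinguished M.
Proof.
suff step m (N : representation k G) : (rdegree N < m)%N -> distinguished N ->
    exists2 M : representation k G, indecomposable M & distinguished M.
  apply: (step (rdegree X).+1 X) => //; exists 1%:M, 1%:M.
  by split; rewrite ?mulmx1 ?norm_char1 ?oner_neq0 //; apply: intertwines1.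
elim: m N => // m IHm N; rewrite ltnS => leNm [a [b [ha hb ba nz_ab]]].
have [indN | nindN] := classic (indecomposable N).
  by exists N => //; exists a, b.
have N_gt0 : (0 < rdegree N)%N.
  rewrite lt0n; apply: contra_neq nz_ab => N0.
  suff -> : a *m b = 0 by exact: norm_char0.
  apply/matrixP=> i l; rewrite !mxE big1 // => x _.
  by have := leq_ltn_trans (leq0n x) (ltn_ord x)=> N_gt0; rewrite N0 in N_gt0.
have [M1 [M2 [dM [nz1 nz2]]]] : exists M1 M2 : representation k G,
    mx_rsim N (dadd_grepr M1 M2) /\ (rdegree M1 != 0 /\ rdegree M2 != 0)%N.
  apply: NNPP => no; apply: nindN; split=> // M1 M2 dM.
  have [-> | nz1] := eqVneq (rdegree M1) 0%N; first by left.
  have [-> | nz2] := eqVneq (rdegree M2) 0%N; first by right.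
  by case: no; exists M1, M2.
have degN : rdegree N = (rdegree M1 + rdegree M2)%N := mxrank_rsim dM.
have [a1 [b1 [a2 [b2 [[ha1 hb1] ba1 [ha2 hb2] ba2 ab12]]]]] := dadd_decomposition dM.
have h1 : intertwines G X X (a *m a1 *m (b1 *m b)).
  exact: intertwinesM (intertwinesM hb hb1) (intertwinesM ha1 ha).
have h2 : intertwines G X X (a *m a2 *m (b2 *m b)).
  exact: intertwinesM (intertwinesM hb hb2) (intertwinesM ha2 ha).
have Dab : a *m b = a *m a1 *m (b1 *m b) + a *m a2 *m (b2 *m b).
  rewrite -{1}[a]mulmx1 -ab12 mulmxDr mulmxDl; congr (_ + _); by rewrite !mulmxA.
have split_sub (M : representation k G) c d : intertwines G M N c ->
    intertwines G N M d -> d *m c = 1%:M ->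
    norm_char (a *m c *m (d *m b)) != 0 -> distinguished M.
  move=> hc hd dc nz; exists (a *m c), (d *m b); split=> //.
  - exact: intertwinesM hc ha.
  - exact: intertwinesM hb hd.
  - by rewrite mulmxA -[d *m b *m a]mulmxA ba mulmx1.
have [E1 | nzE1] := eqVneq (norm_char (a *m a1 *m (b1 *m b))) 0; last first.
  apply: (IHm M1) (split_sub _ _ _ ha1 hb1 ba1 nzE1).
  by apply: leq_trans leNm; rewrite degN -addn1 leq_add2l lt0n.
apply: (IHm M2); last first.
  apply: (split_sub _ _ _ ha2 hb2 ba2); apply: contra_neq nz_ab => E2.
  by rewrite Dab (norm_charD h1 h2) E1 E2 addr0.
by apply: leq_trans leNm; rewrite degN -add1n leq_add2r lt0n.
Qed.

(** A trace from W is the sum of a V-equivariant family indexed by the cosets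
    of W, and V cannot fix such a coset when W is smaller than V. *)
Lemma norm_char_rel_trace (W : {group gT}) psi :
  W \proper V -> intertwines W X X psi -> norm_char (rel_trace X X W G psi) = 0.
Proof.
move=> pWV hpsi; have sWV := proper_sub pWV; have sWG := subset_trans sWV sVG.
set phi := rel_trace _ _ _ _ _.
have hphi : intertwines G X X phi := rel_trace_hom sWG (subxx G) hpsi.
pose K := invmx A *m (phi *m j)^T *m B.
have hK : intertwines V X Z K := intertwines_adjoint uA invA invBV (homj hphi).
pose F C := K *m conj_mx X X psi (repr C) *m j.
have -> : norm_char phi = eigval (\sum_(C in rcosets W G) F C).
  rewrite /norm_char /form_norm; congr (eigval _).
  rewrite -mulmx_suml -mulmx_sumr /K -/phi.
  by rewrite -!mulmxA.
have [_ _ _] := indX.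
rewrite (equivariant_sum (subxx V) killZ (to := 'Rs%act)).
- rewrite big1 // => C /andP[/rcosetsP[x Gx ->] /afixP fixC].
  have: V :^ x^-1 \subset W.
    apply/subsetP=> y; rewrite mem_conjgV => /fixC /=; rewrite rcosetE.
    by move/rcoset_fixed_mem; rewrite conjgK.
  by move/subset_leq_card; rewrite cardJg leqNgt proper_card.
- exact: subset_trans sVG (actsRs_rcosets W G).
move=> v C Vv /(rcosets_repr sWG)[GC DC]; have Gv := subsetP sVG v Vv.
rewrite /F /= rcosetE {1}DC -rcosetM conj_mx_repr ?groupM //.
rewrite -conj_mxM // {1}/conj_mx [K *m _]mulmxA [K *m (_ *m _)]mulmxA.
rewrite hK ?groupV // -[LHS]mulmxA -hj //.
by rewrite /conj_mx !mulmxA.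
Qed.

Lemma distinguished_vertex N (W : {group gT}) :
  distinguished N -> W \proper V -> ~ relatively_projective N W.
Proof.
case=> a [b [ha hb ba nz_ab]] pWV /relatively_projective_trace[sWG [psi hpsi psi1]].
case/eqP: nz_ab.
have -> : a *m b = rel_trace X X W G (a *m (psi *m b)).
  by rewrite (rel_traceMl sWG _ ha) (rel_traceMr sWG _ hb) psi1 mul1mx.
apply: norm_char_rel_trace pWV _.
exact: intertwinesM (intertwinesM (intertwinesS sWG hb) hpsi) (intertwinesS sWG ha).
Qed.

Lemma norm_char_mul_unit phi : intertwines G X X phi -> phi \in unitmx ->
  norm_char phi != 0.
Proof.
move=> hphi uphi; have hphi' := intertwinesV uphi hphi.
have := norm_charM hphi hphi'; rewrite mulmxV // norm_char1 => E.
by apply: contra_eq_neq E => ->; rewrite mul0r oner_eq0.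
Qed.

(** With e = a b the projection onto N, the endomorphism s of N defined below
    satisfies a s b = e e* (B^-1 D) e, where e* is the adjoint of e; each factor
    has non-zero norm, hence s is invertible, and a^T D a is a factor of s. *)
Lemma distinguished_form_unit (N : representation k G) a b D : indecomposable N ->
  intertwines G N X a -> intertwines G X N b -> b *m a = 1%:M ->
  norm_char (a *m b) != 0 -> intertwines G X (dual X) D -> D \in unitmx ->
  a^T *m D *m a \in unitmx.
Proof.
move=> indN ha hb ba nz_ab hD uD; have uB := induced_form_unit.
pose f := a *m b; have hf : intertwines G X X f := intertwinesM hb ha.
pose f' := invmx B *m f^T *m B; pose d := invmx B *m D.
have hf' : intertwines G X X f' := intertwines_adjoint uB invB invB hf.
have hd : intertwines G X X d := intertwinesM hD (intertwinesV uB invB).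
have ud : d \in unitmx by rewrite unitmx_mul unitmx_inv uB uD.
pose S := a^T *m D *m a; pose s := b *m invmx B *m b^T *m S.
have asb : a *m s *m b = f *m f' *m d *m f.
  rewrite /s /S /f' /d /f trmx_mul -!mulmxA; congr (_ *m (_ *m (_ *m (_ *m (_ *m _))))).
  by rewrite [B *m (invmx B *m _)]mulKVmx.
have hs : intertwines G N N s.
  have hS := intertwines_pullback hD ha.
  have h1 : intertwines G (dual N) N (b *m invmx B *m b^T).
    rewrite -mulmxA.
    exact: intertwinesM (intertwinesM (intertwines_tr hb) (intertwinesV uB invB)) hb.
  exact: intertwinesM hS h1.
have : s \in unitmx.
  apply: (norm_char_unit ha hb ba nz_ab indN hs); rewrite asb.
  rewrite (norm_charM (intertwinesM hd (intertwinesM hf' hf)) hf).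
  rewrite (norm_charM (intertwinesM hf' hf) hd) (norm_charM hf hf').
  rewrite (norm_char_adjoint hf).
  by rewrite (mulf_neq0 (mulf_neq0 (mulf_neq0 nz_ab nz_ab) (norm_char_mul_unit hd ud)) nz_ab).
by rewrite unitmx_mul => /andP[].
Qed.

(** The projection onto a second copy of N has the norm of a b, because the two
    are products of the same two endomorphisms in either order; but its product
    with a b is zero. *)
Lemma distinguished_not_component (N N' : representation k G) a b c d :
  intertwines G N X a -> intertwines G X N b -> b *m a = 1%:M ->
  norm_char (a *m b) != 0 ->
  intertwines G N' X c -> intertwines G X N' d ->
  a *m b + c *m d = 1%:M -> d *m c = 1%:M -> ~ component N N'.
Proof.
move=> ha hb ba nz_ab hc hd abcd dc /componentP[a2 [b2 [ha2 hb2 ba2]]].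
have hca2 : intertwines G N X (c *m a2) := intertwinesM ha2 hc.
have hb2d : intertwines G X N (b2 *m d) := intertwinesM hd hb2.
have h1 : intertwines G X X (c *m a2 *m b) := intertwinesM hb hca2.
have h2 : intertwines G X X (a *m (b2 *m d)) := intertwinesM hb2d ha.
have hab : intertwines G X X (a *m b) := intertwinesM hb ha.
have [_ da] := complementary_orthogonal ba dc abcd.
have E1 : a *m (b2 *m d) *m (c *m a2 *m b) = a *m b.
  rewrite -!mulmxA [d *m (c *m _)]mulmxA dc mul1mx [b2 *m (a2 *m _)]mulmxA.
  by rewrite ba2 mul1mx.
have E2 : c *m a2 *m b *m (a *m (b2 *m d)) *m (a *m b) = 0.
  by rewrite -!mulmxA [d *m (a *m _)]mulmxA da mul0mx !mulmx0.
have P1 := norm_charM h2 h1; rewrite E1 in P1.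
have P2 := norm_charM (intertwinesM h2 h1) hab.
rewrite E2 norm_char0 (norm_charM h1 h2) in P2.
case/eqP: (mulf_neq0 nz_ab nz_ab).
by rewrite {1}P1 (mulrC (norm_char (a *m (b2 *m d)))) -P2.
Qed.

(** Inflate D to the form b^T D b on X, along which a gam has non-zero norm. By
    form_norm_mul the norm of B along a gam is not zero; as a b fixes a gam, the
    norm of a b is 1. *)
Lemma source_component_distinguished (N : representation k G) a b D gam :
  intertwines G N X a -> intertwines G X N b -> b *m a = 1%:M ->
  D^T = D -> intertwines G N (dual N) D -> intertwines V Z N gam ->
  gam^T *m D *m gam \in unitmx -> norm_char (a *m b) != 0.
Proof.
move=> ha hb ba symD hD hg ug.
pose D' := b^T *m D *m b; pose gam' := a *m gam.
have hD' : intertwines G X (dual X) D' := intertwines_pullback hD hb.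
have symD' : D'^T = D' := tr_bilinear b b symD.
have hg' : intertwines V Z X gam' := intertwinesM hg (intertwinesS sVG ha).
have hab : intertwines G X X (a *m b) := intertwinesM hb ha.
have hgDg := intertwines_pullback (intertwinesS sVG hD) hg.
have nz : form_norm D' gam' != 0.
  have bag : b *m gam' = gam by rewrite /gam' mulmxA ba mul1mx.
  have E : gam'^T *m D' *m gam' = gam^T *m D *m gam.
    have pull (g : 'M[k]_(rdegree X, rdegree Z)) :
      g^T *m (b^T *m D *m b) *m g = (b *m g)^T *m D *m (b *m g).
      by rewrite trmx_mul !mulmxA.
    by rewrite pull bag.
  rewrite /form_norm E (eigval_neq0 indZ (invariant_endo hgDg)).
  by rewrite unitmx_mul unitmx_inv uA.
have abg : a *m b *m gam' = gam' by rewrite /gam' mulmxA -[_ *m b *m a]mulmxA ba mulmx1.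
move: nz; rewrite (form_norm_mul symD' hD' hg') -{1}abg (form_norm_endo hab hg').
by rewrite !mulf_eq0 !negb_or => /and3P[_ nz _]; exact: nz.
Qed.

(** Take for gam the adjoint of a, restricted to Z: the pullback of H along it is
    the pullback of B along the self-adjoint projection f onto N, whose norm is
    not zero because f and a b fix each other. *)
Lemma distinguished_source_component (N : representation k G) a b : indecomposable N ->
  intertwines G N X a -> intertwines G X N b -> b *m a = 1%:M ->
  norm_char (a *m b) != 0 ->
  let H := a^T *m B *m a in
  exists2 gam, intertwines V Z N gam & gam^T *m H *m gam \in unitmx.
Proof.
move=> indN ha hb ba nz_ab H.
have uH : H \in unitmx.
  exact: distinguished_form_unit indN ha hb ba nz_ab invB induced_form_unit.
have hH : intertwines G N (dual N) H := intertwines_pullback invB ha.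
have symH : H^T = H := tr_bilinear a a symB.
pose b' := invmx H *m a^T *m B; pose f := a *m b'.
have hb' : intertwines G X N b' := intertwines_adjoint uH hH invB ha.
have hab : intertwines G X X (a *m b) := intertwinesM hb ha.
have hf : intertwines G X X f := intertwinesM hb' ha.
have b'a : b' *m a = 1%:M by rewrite /b' -!mulmxA [a^T *m _]mulmxA mulVmx.
have nz_f : norm_char f != 0.
  have E : f *m (a *m b) = a *m b by rewrite /f mulmxA -[_ *m b' *m a]mulmxA b'a mulmx1.
  by move: nz_ab; rewrite -{1}E (norm_charM hf hab) mulf_eq0 negb_or => /andP[nz _]; exact: nz.
exists (b' *m j); first exact: intertwinesM hj (intertwinesS sVG hb').
have E : (b' *m j)^T *m H *m (b' *m j) = (f *m j)^T *m B *m (f *m j).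
  rewrite /H /f; move: (b') => g; rewrite !trmx_mul.
  by rewrite !mulmxA.
have hE := form_endo invBV (homj hf).
have : eigval (invmx A *m ((f *m j)^T *m B *m (f *m j))) != 0 by [].
by rewrite E (eigval_neq0 indZ hE) unitmx_mul unitmx_inv uA.
Qed.

Lemma induced_form_trace : B = rel_trace X (dual X) V G (q^T *m A *m q).
Proof.
by rewrite -Bj -mulmxA (rel_traceMl sVG _ invB) jq1 mulmx1.
Qed.

(** Let f = u b be the self-adjoint projection onto the image of u. The
    endomorphism beta' beta of N has trace 1. Expanding q f u over the blocks
    writes it as a sum over pairs of blocks, of which only the fixed ones on the
    diagonal matter; each of them contributes the corresponding term of the norm
    of f, up to an endomorphism that factors through a singular form on Z and
    has trace value 0 by source_rank. Hence the norm of f is 1. *)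
Lemma nondegenerate_distinguished (N : representation k G)
    (u : 'M[k]_(rdegree X, rdegree N)) : indecomposable N ->
  (forall W : {group gT}, W \proper V -> ~ relatively_projective N W) ->
  intertwines G N X u -> u^T *m B *m u \in unitmx -> distinguished N.
Proof.
move=> indN vertexN hu; move DH: (u^T *m B *m u) => H uH.
have hH : intertwines G N (dual N) H by rewrite -DH; apply: intertwines_pullback invB hu.
have symH : H^T = H by rewrite -DH; apply: tr_bilinear.
pose b := invmx H *m u^T *m B.
have hb : intertwines G X N b := intertwines_adjoint uH hH invB hu.
have bu : b *m u = 1%:M by rewrite /b -!mulmxA [u^T *m _]mulmxA DH mulVmx.
have hHu : intertwines G (dual X) N (invmx H *m u^T).
  exact: intertwinesM (intertwines_tr hu) (intertwinesV uH hH).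
have DB : invmx H *m u^T *m B *m u = 1%:M by [].
pose f := u *m b; have hf : intertwines G X X f := intertwinesM hb hu.
have fu : f *m u = u by rewrite /f -mulmxA bu mulmx1.
exists u, b; split=> //; rewrite -/f; move: b f hb bu hf fu => b f hb bu hf fu.
have sGG := subxx G; have memG := subsetP sVG.
have huV := intertwinesS sVG hu; have hHV := intertwinesS sVG hH.
pose beta := q *m u; have hbeta : intertwines V N Z beta := intertwinesM huV hq.
pose beta' := invmx H *m beta^T *m A.
have hbeta' : intertwines V Z N beta' := intertwines_adjoint uH hHV invA hbeta.
have beta1 : rel_trace N N V G (beta' *m beta) = 1%:M.
  have -> : beta' *m beta = invmx H *m u^T *m (q^T *m A *m q *m u).
    by rewrite /beta' /beta trmx_mul !mulmxA.
  rewrite (rel_traceMl sVG _ hHu) (rel_traceMr sVG _ hu) -induced_form_trace.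
  by rewrite mulmxA DB.
pose tau := @trace_val k gT G V N.
have killN : kills_proper_traces V N tau := kills_proper_traces_trace indN sVG vertexN.
have tau1 : tau (beta' *m beta) = 1 by rewrite /tau /trace_val beta1 (eigval1 indN).
have tau0 psi : intertwines V N N psi -> (\rank psi < rdegree Z)%N -> tau psi = 0.
  move=> hpsi; rewrite ltnNge => /negP le; apply/eqP/negP=> /negP nz; apply: le.
  exact: (source_rank sVG indZ indN vertexN hbeta hbeta' beta1 hpsi nz).
have HG x : x \in G -> invmx H *m (N x)^T = N x^-1%g *m invmx H.
  move=> Gx; have GxV : x^-1%g \in G by rewrite groupV.
  by rewrite -(intertwinesV uH hH GxV) dualE invgK.
have tau_adj psi : intertwines V N N psi -> tau (invmx H *m psi^T *m H) = tau psi.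
  move=> hpsi; have htr := rel_trace_hom sVG sGG hpsi.
  have E : rel_trace N N V G (invmx H *m psi^T *m H)
           = invmx H *m (rel_trace N N V G psi)^T *m H.
    rewrite /rel_trace raddf_sum mulmx_sumr mulmx_suml; apply: eq_bigr => C.
    case/(rcosets_repr sVG) => GC _ /=.
    rewrite /conj_mx !trmx_mul !mulmxA HG // -[RHS]mulmxA -[_ *m H *m N _]mulmxA.
    by rewrite (hH _ GC) dualE -!mulmxA.
  rewrite /tau /trace_val E; apply: eigval_adjoint => //.
  exact: (intertwines_adjoint uH hH hH htr).
pose p C := conj_mx X X (j *m q) (repr C).
have hjq : intertwines V X X (j *m q) := intertwinesM hq hj.
(* The decomposition of beta = q f u along the blocks between f and u. *)
pose w C := q *m f *m (p C *m u).
have Dbeta : beta = \sum_(C in rcosets V G) w C.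
  have p1 : \sum_(C in rcosets V G) p C = 1%:M by exact: jq1.
  by rewrite -mulmx_sumr -mulmx_suml p1 mul1mx -mulmxA fu.
pose F C D := invmx H *m ((w C)^T *m A *m w D).
have : tau (\sum_(C in rcosets V G) \sum_(D in rcosets V G) F C D) = 1.
  rewrite -tau1; congr (tau _); rewrite /beta' -!mulmxA Dbeta.
  rewrite [(\sum_(C in _) w C)^T]raddf_sum mulmx_suml mulmx_sumr.
  apply: eq_bigr => C _; rewrite !mulmx_sumr.
  by apply: eq_bigr => D _; rewrite /F -!mulmxA.
have wM C v : C \in rcosets V G -> v \in V ->
    w ('Rs%act C v) = Z v^-1%g *m w C *m N v.
  case/(rcosets_repr sVG) => GC DC Vv; have Gv := memG v Vv.
  rewrite /w /p /= rcosetE {1}DC -rcosetM conj_mx_repr ?groupM // -conj_mxM //.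
  move: (conj_mx X X (j *m q) (repr C)) => pC; rewrite /conj_mx.
  rewrite -!mulmxA -hu // [f *m _]mulmxA hf ?groupV // -!mulmxA.
  by rewrite [q *m (X _ *m _)]mulmxA hq ?groupV // -!mulmxA.
rewrite (equivariant_sum_symmetric sVG killN (to := 'Rs%act)
  (adj := fun psi => invmx H *m psi^T *m H) char2); last first.
- move=> C1 C2 C1G C2G v Vv; rewrite /F !wM //.
  move: (w C1) (w C2) => w1 w2; rewrite /conj_mx !trmx_mul.
  have VvV : v^-1%g \in V by rewrite groupV.
  have E := invariant_cancel (subxx V) VvV invA.
  by rewrite -[in RHS]E !mulmxA HG ?memG.
- by move=> C1 C2 C1G C2G; rewrite /F -(adjoint_compared _ symH uH) tr_bilinear.
- exact: tau_adj.
- exact: subset_trans sVG (actsRs_rcosets V G).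
rewrite (eq_bigl _ _ (fixed_rcosets G V)).
have -> : norm_char f = \sum_(C in rcosets V 'N_G(V)) tau (F C C); last first.
  by move=> ->; apply: oner_neq0.
rewrite /norm_char (form_norm_coef (homj hf)).
rewrite -(sum_rcosets_norm_inv sVG (f := twisted_coef (f *m j))); last first.
  by move=> v x Vv /setIP[Gx _]; apply: twisted_coefM.
apply: eq_bigr => C /(rcosets_repr _)[|NC _].
  by rewrite subsetI sVG normG.
have /setIP[GC NV] := NC.
rewrite /F /w /p /conj_mx; move: (repr C) GC NV => x Gx NVx {NC}.
pose c := q *m X x^-1%g *m (f *m j).
have GxV : x^-1%g \in G by rewrite groupV.
have NxV : x^-1%g \in 'N(V) by rewrite groupV.
have hc : twisted x^-1%g c := twisted_component GxV NxV hf hj.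
have -> : q *m f *m (X x^-1%g *m (j *m q) *m X x *m u) = c *m beta *m N x.
  rewrite /c /beta -!mulmxA -hu // [f *m (X _ *m _)]mulmxA hf // -!mulmxA.
  by [].
rewrite /twisted_coef -/c.
have hcA := twisted_pullback NxV hc invA.
have [D0 [hD0 nD0]] := invariant_decomposition hcA.
move: (eigval _) => lam DD.
have hN D : intertwines V Z (dual Z) D ->
    intertwines V N N (invmx H *m (beta^T *m D *m beta)).
  move=> hD; apply: intertwinesM (intertwinesV uH hHV).
  exact: intertwines_pullback hD hbeta.
pose psi D := invmx H *m (beta^T *m D *m beta).
have -> : invmx H *m ((c *m beta *m N x)^T *m A *m (c *m beta *m N x))
          = conj_mx N N (psi (c^T *m A *m c)) x.
  rewrite /conj_mx /psi.
  move: c {hc hcA DD} beta {hbeta beta' hbeta' beta1 tau1 tau0 Dbeta hN psi} => c beta.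
  by rewrite !trmx_mul !mulmxA HG.
have -> : tau (conj_mx N N (psi (c^T *m A *m c)) x) = tau (psi (c^T *m A *m c)).
  by rewrite /tau /trace_val (rel_trace_norm sVG sGG Gx NVx (hN _ hcA)).
rewrite DD.
have -> : psi (lam *: A + D0) = lam *: psi A + psi D0.
  by rewrite /psi mulmxDr mulmxDl mulmxDr -scalemxAr -scalemxAl -scalemxAr.
have [_ tauD _] := killN.
rewrite (tauD _ _ (intertwinesZ lam (hN _ invA)) (hN _ hD0)).
have -> : tau (psi D0) = 0.
  apply: (tau0 _ (hN _ hD0)); rewrite /psi.
  apply: leq_ltn_trans (mxrankM_maxr _ _) _.
  apply: leq_ltn_trans (mxrankM_maxl _ _) _.
  apply: leq_ltn_trans (mxrankM_maxr _ _) _.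
  by rewrite ltn_neqAle rank_leq_row andbT -[_ == _]/(row_free D0) row_free_unit.
rewrite addr0 /tau /trace_val rel_traceZ (eigvalZ indN).
  have -> : invmx H *m (beta^T *m A *m beta) = beta' *m beta by rewrite /beta' !mulmxA.
  by rewrite beta1 (eigval1 indN) mulr1.
exact (rel_trace_hom sVG sGG (hN _ invA)).
Qed.

End NormCharacter.

(** * Self-dual components of odd multiplicity *)

Section Multiplicity.

Variables (k : fieldType) (gT : finGroupType) (G : {group gT}).
Variable N : representation k G.

Lemma muln_greprS m : muln_grepr N m.+1 = dadd_grepr N (muln_grepr N m).
Proof. by rewrite /muln_grepr big_ord_recl. Qed.

(** The multiple N^m enters through its m inclusions and projections only. *)
Lemma muln_decomposition m :
  exists (inj : 'I_m -> 'M[k]_(rdegree (muln_grepr N m), rdegree N)) prj,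
  [/\ forall i, intertwines G N (muln_grepr N m) (inj i),
      forall i, intertwines G (muln_grepr N m) N (prj i),
      forall i l, prj i *m inj l = (i == l)%:R%:M
    & \sum_i inj i *m prj i = 1%:M].
Proof.
elim: m => [|m [inj [prj [hinj hprj prj_inj sum1]]]].
  exists (fun=> 0), (fun=> 0); split; try by case.
  by rewrite big_ord0 /muln_grepr big_ord0; apply/matrixP=> [[]].
rewrite muln_greprS; set P := muln_grepr N m in inj prj hinj hprj prj_inj sum1 *.
have [a [b [c [d [[ha hb] ba [hc hd] dc abcd]]]]] :=
  dadd_decomposition (mx_rsim_refl (dadd_grepr N P)).
have [bc da] := complementary_orthogonal ba dc abcd.
exists (fun i => if unlift ord0 i is Some i' then c *m inj i' else a).
exists (fun i => if unlift ord0 i is Some i' then prj i' *m d else b).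
split=> [i | i | i l |].
- by case: (unlift ord0 i) => [i'|] //; apply: intertwinesM (hinj i') hc.
- by case: (unlift ord0 i) => [i'|] //; apply: intertwinesM hd (hprj i').
- case: (unliftP ord0 i) => [i'|] ->; case: (unliftP ord0 l) => [l'|] ->.
  + by rewrite mulmxA -(mulmxA _ d) dc mulmx1 prj_inj (inj_eq lift_inj).
  + by rewrite -mulmxA da mulmx0 -[_ == _]/false mulr0n raddf0.
  + by rewrite mulmxA bc mul0mx -[_ == _]/false mulr0n raddf0.
  + by rewrite ba eqxx.
rewrite big_ord_recl unlift_none -[RHS]abcd; congr (_ + _).
under eq_bigr do rewrite liftK mulmxA -(mulmxA c).
by rewrite -mulmx_suml -mulmx_sumr sum1 mulmx1.
Qed.

End Multiplicity.

Lemma intertwines_form_tr (k : fieldType) (gT : finGroupType) (G : {group gT})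
    (M : representation k G) D :
  intertwines G M (dual M) D -> intertwines G M (dual M) D^T.
Proof.
move=> hD x Gx; rewrite dualE -trmx_mul -[M x]trmxK -trmx_mul; congr (_^T).
by rewrite hD ?groupV // dualE invgK.
Qed.

Section OddMultiplicity.

Variables (k : closedFieldType) (gT : finGroupType) (G : {group gT}).
Hypothesis char2 : 2%N \in [pchar k].
Variable N : representation k G.
Hypothesis indN : indecomposable N.

(** Comparing bilinear forms on N with a fixed isomorphism onto the dual, the
    passage to the transposed form multiplies the eigenvalue by a constant of
    square one, hence by one. *)
Lemma eigval_tr_compared (theta phi : 'M[k]_(rdegree N)) : theta \in unitmx ->
  intertwines G N (dual N) theta -> intertwines G N (dual N) phi ->
  eigval (invmx theta *m phi^T) = eigval (invmx theta *m phi).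
Proof.
move=> ut ht; have ht' := intertwinesV ut ht.
have hE psi : intertwines G N (dual N) psi -> intertwines G N N (invmx theta *m psi).
  by move=> hpsi; apply: intertwinesM hpsi ht'.
set c := eigval (invmx theta *m theta^T).
have trE psi : intertwines G N (dual N) psi ->
    eigval (invmx theta *m psi^T) = eigval (invmx theta *m psi) * c.
  move=> hpsi; have h := hE _ hpsi.
  have ha : intertwines G N N (invmx theta *m (invmx theta *m psi)^T *m theta).
    exact: (intertwines_adjoint ut ht ht h).
  have -> : invmx theta *m psi^T
      = invmx theta *m (invmx theta *m psi)^T *m theta *m (invmx theta *m theta^T).
    rewrite -!mulmxA mulKVmx //; congr (_ *m _).
    by rewrite -trmx_mul mulKVmx.
  rewrite (eigvalM indN ha (hE _ (intertwines_form_tr ht))).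
  by rewrite (eigval_adjoint indN ut h ha).
suff c1 : c = 1 by move=> hphi; rewrite trE // c1 mulr1.
have := trE _ (intertwines_form_tr ht); rewrite trmxK mulVmx // (eigval1 indN) -/c.
by move/eqP; rewrite eq_sym -expr2 sqrf_eq1 oppr_pchar2 // orbb => /eqP.
Qed.

Variables (X : representation k G) (B : 'M[k]_(rdegree X)).
Hypotheses (symB : B^T = B) (uB : B \in unitmx) (invB : intertwines G X (dual X) B).

(** The matrix S of B on the multiplicity space is symmetric, and its diagonal
    vanishes unless some inclusion of N will do for u. In odd size an alternating
    matrix has a kernel; a kernel vector v gives a map u, orthogonal to all the
    inclusions, that is split by one of the projections P. Expanding P u by the
    adjoint of the decomposition of X shows that it is not invertible, unless N
    is a component of the complement. *)
Lemma odd_multiplicity_nondegenerate m :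
  self_dual N -> odd m -> has_multiplicity N X m ->
  exists2 u, intertwines G N X u & u^T *m B *m u \in unitmx.
Proof.
case/mx_rsimP=> theta [theta' [ht _ t't tt']] odd_m [N' decX nN'].
have ut : theta \in unitmx by case: (mulmx1_unit tt').
have ht' := intertwinesV ut ht.
have [a [b [eta [kap [[ha hb] ba [heta hkap] _ abek]]]]] := dadd_decomposition decX.
have [inj [prj [hinj hprj prj_inj sum1]]] := muln_decomposition N m.
pose I i := a *m inj i; pose P i := prj i *m b.
have hI i : intertwines G N X (I i) := intertwinesM (hinj i) ha.
have hP i : intertwines G X N (P i) := intertwinesM hb (hprj i).
have PI i l : P i *m I l = (i == l)%:R%:M.
  by rewrite /P /I mulmxA -(mulmxA _ b) ba mulmx1 prj_inj.
have IP1 : \sum_i I i *m P i + eta *m kap = 1%:M.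
  rewrite -abek; congr (_ + _); rewrite /I /P.
  under eq_bigr do rewrite mulmxA -(mulmxA a).
  by rewrite -mulmx_suml -mulmx_sumr sum1 mulmx1.
clearbody I P.
apply: NNPP => no.
have sing u : intertwines G N X u -> u^T *m B *m u \notin unitmx.
  by move=> hu; apply/negP=> uu; apply: no; exists u.
have hcr u v : intertwines G N X u -> intertwines G N X v ->
    intertwines G N (dual N) (u^T *m B *m v).
  move=> hu hv; rewrite -mulmxA.
  exact: (intertwinesM (intertwinesM hv invB) (intertwines_tr hu)).
have hcr' u v (hu : intertwines G N X u) (hv : intertwines G N X v) :
  intertwines G N N (invmx theta *m (u^T *m B *m v)) := intertwinesM (hcr u v hu hv) ht'.
pose S := \matrix_(i, l) eigval (invmx theta *m ((I i)^T *m B *m I l)).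
have symS u v : intertwines G N X u -> intertwines G N X v ->
    eigval (invmx theta *m (u^T *m B *m v)) = eigval (invmx theta *m (v^T *m B *m u)).
  move=> hu hv; rewrite -(tr_bilinear v u symB).
  exact: (eigval_tr_compared ut ht (hcr v u hv hu)).
have detS : \det S == 0.
  apply/eqP/det_odd_alternating => //.
    by apply/matrixP=> i l; rewrite !mxE symS.
  move=> i; rewrite mxE; apply/eqP.
  by rewrite (eigval_eq0 indN (hcr' _ _ (hI i) (hI i))) unitmx_mul (negPf (sing _ (hI i))) andbF.
have /det0P[v nz_v vS] := detS.
have [i0 nz_i0] : exists i, v 0 i != 0.
  apply/existsP; apply: contraR nz_v; rewrite negb_exists => /forallP v0.
  by apply/eqP/rowP=> i; rewrite mxE; apply/eqP; rewrite -[_ == _]negbK v0.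
pose u := \sum_i v 0 i *: I i.
have hu : intertwines G N X u.
  by apply: intertwines_sum => i _; apply: intertwinesZ.
have Pu : P i0 *m u = (v 0 i0)%:M.
  rewrite mulmx_sumr (bigD1 i0) //= big1 ?addr0 => [|i /negPf ni]; last first.
    by rewrite -scalemxAr PI eq_sym ni scale_scalar_mx mulr0 raddf0.
  by rewrite -scalemxAr PI eqxx scale_scalar_mx mulr1.
have orth l : eigval (invmx theta *m ((I l)^T *m B *m u)) = 0.
  have -> : invmx theta *m ((I l)^T *m B *m u)
      = \sum_i v 0 i *: (invmx theta *m ((I l)^T *m B *m I i)).
    rewrite /u !mulmx_sumr; apply: eq_bigr => i _.
    by rewrite -!scalemxAr.
  rewrite (eigval_sum indN) => [|i _]; last exact: intertwinesZ (hcr' _ _ (hI l) (hI i)).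
  have := congr1 (fun w : 'rV_m => w 0 l) vS; rewrite !mxE => E; rewrite -[RHS]E.
  apply: eq_bigr => i _; rewrite mxE (eigvalZ indN _ (hcr' _ _ (hI l) (hI i))).
  by rewrite symS.
clearbody u; have hBV := intertwinesV uB invB.
have hPB i : intertwines G (dual N) N (P i0 *m (invmx B *m (P i)^T)).
  exact: (intertwinesM (intertwinesM (intertwines_tr (hP i)) hBV) (hP i0)).
pose t := P i0 *m (invmx B *m kap^T) *m (eta^T *m B *m u).
have heu : intertwines G N (dual N') (eta^T *m B *m u).
  rewrite -mulmxA; exact: (intertwinesM (intertwinesM hu invB) (intertwines_tr heta)).
have hpk : intertwines G (dual N') N (P i0 *m (invmx B *m kap^T)).
  exact: (intertwinesM (intertwinesM (intertwines_tr hkap) hBV) (hP i0)).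
have hth : intertwines G N N t := intertwinesM heu hpk.
have eig_t : eigval t = 0.
  apply/eqP; rewrite (eigval_eq0 indN hth); apply/negP=> utt; apply: nN'.
  apply/componentP.
  have htV := intertwinesV utt hth.
  pose x := kap *m (invmx B *m (P i0)^T) *m theta.
  pose y := invmx theta *m (invmx t)^T *m (u^T *m B *m eta).
  have hx : intertwines G N N' x.
    exact: (intertwinesM ht (intertwinesM (intertwinesM (intertwines_tr (hP i0)) hBV) hkap)).
  have hy : intertwines G N' N y.
    have h1 : intertwines G N' (dual N) (u^T *m B *m eta).
      rewrite -mulmxA.
      exact: (intertwinesM (intertwinesM heta invB) (intertwines_tr hu)).
    exact: (intertwinesM h1 (intertwinesM (intertwines_tr htV) ht')).
  exists x, y; split=> //.
  have Dt : t^T = u^T *m B *m eta *m (kap *m (invmx B *m (P i0)^T)).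
    rewrite /t trmx_mul (tr_bilinear eta u symB); congr (_ *m _).
    by rewrite !trmx_mul trmxK trmx_inv symB !mulmxA.
  have -> : y *m x = invmx theta *m ((invmx t)^T *m t^T) *m theta.
    by rewrite Dt /x /y !mulmxA.
  by rewrite -trmx_mul mulmxV // trmx1 mulmx1 mulVmx.
have Eu : P i0 *m u = \sum_l P i0 *m (invmx B *m (P l)^T) *m theta
                          *m (invmx theta *m ((I l)^T *m B *m u)) + t.
  have Id : invmx B *m (\sum_i I i *m P i + eta *m kap)^T *m B = 1%:M.
    by rewrite IP1 trmx1 mulmx1 mulVmx.
  rewrite -[in LHS](mul1mx u) -Id [(_ + _)^T]raddfD /= raddf_sum /=.
  rewrite mulmxDr !mulmxDl mulmxDr mulmx_sumr !mulmx_suml mulmx_sumr.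
  congr (_ + _); last by rewrite /t trmx_mul !mulmxA.
  apply: eq_bigr => i _; rewrite trmx_mul -[in RHS]mulmxA mulKVmx //.
  by rewrite !mulmxA.
case/eqP: nz_i0; rewrite -(eigval_scalar indN (v 0 i0)) -Pu Eu.
have hterm l : intertwines G N N (P i0 *m (invmx B *m (P l)^T) *m theta
                          *m (invmx theta *m ((I l)^T *m B *m u))).
  exact: (intertwinesM (hcr' _ _ (hI l) hu) (intertwinesM ht (hPB l))).
rewrite (eigvalD indN _ hth); last by apply: intertwines_sum => l _; apply: hterm.
rewrite eig_t addr0 (eigval_sum indN) => [|l _]; last exact: hterm.
apply: big1 => l _.
rewrite (eigvalM indN (intertwinesM ht (hPB l)) (hcr' _ _ (hI l) hu)).
by rewrite orth mulr0.
Qed.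

End OddMultiplicity.

(** * Forms and their matrices *)

Section FormMatrices.

Variables (k : fieldType) (n : nat).

(** The proof of symmetry is an argument of the function, so that the function
    alone determines its structure of symmetric form. *)
Definition matrix_form (D : 'M[k]_n) (symD : D^T = D) (u v : 'cV[k]_n) : k :=
  (u^T *m D *m v) 0 0.

Section Instances.

Variables (D : 'M[k]_n) (symD : D^T = D).

Let matrix_form_bilinear :
  bilinear_for (GRing.Scale.Law.clone _ _ *%R _)
    (GRing.Scale.Law.clone _ _ (idfun \; *%R) _) (matrix_form symD).
Proof.
split=> u a v w; rewrite /matrix_form.
  by rewrite linearP /= !mulmxDl -!scalemxAl !mxE.
by rewrite mulmxDr -scalemxAr !mxE.
Qed.

HB.instance Definition _ :=
  bilinear_isBilinear.Build k 'cV[k]_n 'cV[k]_n k _ _ (matrix_form symD)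
    matrix_form_bilinear.

Let matrix_form_hermitian u v :
  matrix_form symD u v = (-1) ^+ false * idfun (matrix_form symD v u).
Proof.
rewrite expr0 mul1r /= /matrix_form -(tr_bilinear u v symD).
by rewrite [RHS]mxE.
Qed.

HB.instance Definition _ :=
  isHermitianSesquilinear.Build k 'cV[k]_n false idfun (matrix_form symD)
    matrix_form_hermitian.

End Instances.

Definition symmetric_of_matrix (D : 'M[k]_n) (symD : D^T = D) :
  {symmetric 'cV[k]_n} := matrix_form symD.

Definition form_matrix (B : {symmetric 'cV[k]_n}) : 'M[k]_n :=
  \matrix_(i, l) B (delta_mx i 0) (delta_mx l 0).

Lemma form_matrixE (B : {symmetric 'cV[k]_n}) u v :
  B u v = (u^T *m form_matrix B *m v) 0 0.
Proof.
have delta (w : 'cV[k]_n) : w = \sum_i w i 0 *: delta_mx i 0.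
  by rewrite {1}(matrix_sum_delta w); apply: eq_bigr => i _; rewrite big_ord1.
have -> : (u^T *m form_matrix B *m v) 0 0
    = \sum_i \sum_l u i 0 * B (delta_mx i 0) (delta_mx l 0) * v l 0.
  rewrite mxE exchange_big; apply: eq_bigr => l _; rewrite mxE mulr_suml.
  by apply: eq_bigr => i _; rewrite !mxE.
rewrite {1}(delta u) linear_sumlz; apply: eq_bigr => i _ /=.
rewrite linearZl_LR /= {1}(delta v) linear_sumr mulr_sumr; apply: eq_bigr => l _.
by rewrite linearZr_LR /= mulrCA mulrC.
Qed.

Lemma form_matrix_sym B : (form_matrix B)^T = form_matrix B.
Proof. by apply/matrixP=> i l; rewrite !mxE hermC expr0 mul1r. Qed.

Lemma form_matrix_of_matrix D (symD : D^T = D) :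
  form_matrix (symmetric_of_matrix symD) = D.
Proof.
apply/matrixP=> i l; rewrite mxE /= /matrix_form trmx_delta -rowE -colE.
by rewrite !mxE.
Qed.

Lemma cV_pairing_eq0 m (w : 'rV[k]_m) : (forall v : 'cV_m, (w *m v) 0 0 = 0) -> w = 0.
Proof.
move=> w0; apply/rowP=> i; have := w0 (delta_mx i 0).
by rewrite -colE !mxE.
Qed.

Lemma bilinear_ext m p (D E : 'M[k]_(m, p)) :
  (forall (u : 'cV_m) (v : 'cV_p), (u^T *m D *m v) 0 0 = (u^T *m E *m v) 0 0) ->
  D = E.
Proof.
move=> eqDE; apply/matrixP=> i l; have := eqDE (delta_mx i 0) (delta_mx l 0).
by rewrite !trmx_delta -!rowE -!colE !mxE.
Qed.

Lemma mul_cV_eq0_unit m (D : 'M[k]_m) :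
  (forall w : 'rV_m, w *m D = 0 -> w = 0) -> D \in unitmx.
Proof.
move=> inj; rewrite unitmxE unitfE; apply/negP=> /det0P[w nz_w wD].
by rewrite (inj w wD) eqxx in nz_w.
Qed.

Lemma nondegenerate_form_matrix B : nondegenerate B -> form_matrix B \in unitmx.
Proof.
move/eqP=> radB; apply: mul_cV_eq0_unit => w wB.
have : w^T \in orthov B fullv.
  apply/mem_orthovP => v _; rewrite form_matrixE trmxK wB mul0mx mxE.
  by [].
by rewrite radB memv0 => /eqP w0; rewrite -[w]trmxK w0 trmx0.
Qed.

Lemma matrix_form_nondegenerate D (symD : D^T = D) :
  D \in unitmx -> nondegenerate (symmetric_of_matrix symD).
Proof.
move=> uD; apply/eqP/vspaceP=> u; rewrite memv0; apply/idP/eqP => [| ->]; last exact: mem0v.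
move/mem_orthovP=> u0; apply: trmx_inj; rewrite trmx0.
have : u^T *m D = 0.
  by apply: cV_pairing_eq0 => v; apply: (u0 v); rewrite memvf.
by move/(congr1 (mulmx^~ (invmx D))); rewrite mulmxK // mul0mx.
Qed.

End FormMatrices.

Section InvariantFormMatrices.

Variables (k : fieldType) (gT : finGroupType).

Lemma Gform_matrix (G : {group gT}) (M : representation k G)
    (B : {symmetric 'cV[k]_(rdegree M)}) :
  Gform M B -> form_matrix B \in unitmx /\ intertwines G M (dual M) (form_matrix B).
Proof.
case=> ndB invB; split; first exact: nondegenerate_form_matrix.
move=> x Gx; have Ginv : x^-1%g \in G by rewrite groupV.
apply: bilinear_ext => u v; rewrite dualE !mulmxA -trmx_mul -form_matrixE.
rewrite -(mulmxA _ (M x)) -form_matrixE -(invB _ Gx (M x^-1%g *m u) v).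
by rewrite mulmxA -repr_mxM // mulgV repr_mx1 mul1mx.
Qed.

Lemma matrix_Gform (G : {group gT}) (M : representation k G) D (symD : D^T = D) :
  D \in unitmx -> intertwines G M (dual M) D -> Gform M (symmetric_of_matrix symD).
Proof.
move=> uD hD; split; first exact: matrix_form_nondegenerate.
move=> x Gx u v; rewrite /= /matrix_form trmx_mul -!mulmxA.
by rewrite [D *m (M x *m v)]mulmxA [(M x)^T *m _]mulmxA [_ *m (D *m M x)]mulmxA
  (invariant_cancel (subxx G) Gx hD).
Qed.

(** A vector in the kernel of the pulled back form is a vector of the image
    orthogonal to the image. *)
Lemma nondegenerate_on_pullback (G : {group gT}) (M : representation k G)
    (B : {symmetric 'cV[k]_(rdegree M)}) n (f : 'M[k]_(rdegree M, n))
    (U : {vspace 'cV[k]_(rdegree M)}) :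
  injective (mulmx f : 'cV_n -> _) -> (forall u, u \in U <-> exists v, u = f *m v) ->
  nondegenerate_on M B U -> f^T *m form_matrix B *m f \in unitmx.
Proof.
move=> injf defU ndU; apply: mul_cV_eq0_unit => w wD.
have : f *m w^T \in (U :&: orthov B U)%VS.
  rewrite memv_cap (iffRL (defU _)) /=; last by exists w^T.
  apply/mem_orthovP => v /defU[v' ->].
  by rewrite form_matrixE trmx_mul trmxK !mulmxA -(mulmxA w) -(mulmxA w) wD mul0mx mxE.
rewrite ndU memv0 => /eqP fw0; apply: trmx_inj; rewrite trmx0; apply: injf.
by rewrite fw0 mulmx0.
Qed.

Lemma image_nondegenerate (G : {group gT}) (M : representation k G)
    (B : {symmetric 'cV[k]_(rdegree M)}) n (f : 'M[k]_(rdegree M, n)) :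
  f^T *m form_matrix B *m f \in unitmx ->
  exists U : {vspace 'cV[k]_(rdegree M)},
    [/\ injective (mulmx f : 'cV_n -> _),
        forall u, u \in U <-> exists v, u = f *m v & nondegenerate_on M B U].
Proof.
move=> uD; exists (limg (linfun (mulmx f : 'cV_n -> 'cV_(rdegree M)))).
have defU u : u \in limg (linfun (mulmx f : 'cV_n -> 'cV_(rdegree M))) <->
    exists v, u = f *m v.
  split=> [/memv_imgP[v _ ->] | [v ->]]; first by exists v; rewrite lfunE.
  by rewrite -[f *m v]lfunE memv_img ?memvf.
split=> //.
  move=> u v E; apply: (can_inj (mulKmx uD)).
  by rewrite -!mulmxA E.
apply/vspaceP=> u; rewrite memv0; apply/idP/eqP=> [|->]; last exact: mem0v.
rewrite memv_cap => /andP[/defU[v ->] /mem_orthovP orth].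
suff -> : v = 0 by rewrite mulmx0.
apply: trmx_inj; rewrite trmx0.
have : v^T *m (f^T *m form_matrix B *m f) = 0.
  apply: cV_pairing_eq0 => w.
  rewrite !mulmxA -trmx_mul -mulmxA -form_matrixE; apply: orth.
  by apply/defU; exists w.
by move/(congr1 (mulmx^~ (invmx (f^T *m form_matrix B *m f)))); rewrite mulmxK // mul0mx.
Qed.

Lemma image_submodule (G : {group gT}) (M L : representation k G)
    (f : 'M[k]_(rdegree M, rdegree L)) (U : {vspace 'cV[k]_(rdegree M)}) :
  intertwines G L M f -> (forall u, u \in U <-> exists v, u = f *m v) ->
  submodule M U.
Proof.
move=> hf defU x Gx u /defU[v ->]; apply/defU; exists (L x *m v).
by rewrite !mulmxA hf.
Qed.

Lemma B_component_matrix (G V : {group gT}) (sVG : V \subset G)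
    (M : representation k G) (B : {symmetric 'cV[k]_(rdegree M)})
    (Z : representation k V) :
  B_component sVG M B Z <-> exists2 f, intertwines V Z M f
                             & f^T *m form_matrix B *m f \in unitmx.
Proof.
split=> [[U [_ [f [hf injf defU]] ndU]] | [f hf uf]].
  by exists f => //; apply: nondegenerate_on_pullback injf defU ndU.
have [U [injf defU ndU]] := image_nondegenerate uf.
exists U; split=> //; last by exists f; split.
exact: (@image_submodule V (res sVG M) Z f U hf defU).
Qed.

Lemma nondegenerate_on_summand_matrix (G : {group gT}) (M N : representation k G)
    (B : {symmetric 'cV[k]_(rdegree M)}) :
  nondegenerate_on_summand M N B -> exists2 f, intertwines G N M f
                             & f^T *m form_matrix B *m f \in unitmx.
Proof.
case=> U [_ [f [hf injf defU]] ndU].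
by exists f => //; apply: nondegenerate_on_pullback injf defU ndU.
Qed.

(** The complement of the image of a is the kernel of b. *)
Lemma matrix_nondegenerate_on_summand (G : {group gT}) (M N : representation k G)
    (B : {symmetric 'cV[k]_(rdegree M)}) a b :
  intertwines G N M a -> intertwines G M N b -> b *m a = 1%:M ->
  a^T *m form_matrix B *m a \in unitmx -> nondegenerate_on_summand M N B.
Proof.
move=> ha hb ba ua; have [U [inja defU ndU]] := image_nondegenerate ua.
exists U; split=> //; last by exists a; split.
split; first exact: image_submodule ha defU.
exists (lker (linfun (mulmx b : 'cV_(rdegree M) -> 'cV_(rdegree N)))); split.
- move=> x Gx u; rewrite !memv_ker !lfunE /= => /eqP bu.
  by rewrite mulmxA hb // -mulmxA bu mulmx0.
- apply/eqP; rewrite eqEsubv subvf /=; apply/subvP=> u _.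
  rewrite -[u](subrK (a *m (b *m u))) addrC; apply: memv_add.
    by apply/defU; exists (b *m u).
  by rewrite memv_ker lfunE /= mulmxBr !mulmxA ba mul1mx subrr.
apply/vspaceP=> u; rewrite memv0 memv_cap; apply/andP/eqP=> [[/defU[v ->]] | ->].
  by rewrite memv_ker lfunE /= mulmxA ba mul1mx => /eqP->; rewrite mulmx0.
by rewrite !mem0v.
Qed.

End InvariantFormMatrices.

Section InducedFormMatrix.

Variables (k : fieldType) (gT : finGroupType) (G V : {group gT}).
Variables (sVG : V \subset G) (L : representation k V).
Local Notation X := (ind sVG L).
Local Notation j := (ind_in sVG L).
Local Notation q := (ind_out sVG L).

Lemma sum_lcosets_inv (R : nmodType) (t : gT -> R) :
  {in V & G, forall v x, t (v * x)%g = t x} ->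
  \sum_(i < #|lcosets V G|) t (coset_rep i)^-1%g = \sum_(C in rcosets V G) t (repr C).
Proof.
move=> tV; rewrite -(big_enum_val (fun C : {set gT} => t (repr C)^-1%g)).
rewrite (reindex_inj invg_inj); apply: eq_big => [C | C].
  by rewrite -mem_invg invg_lcosets !invGid.
rewrite -mem_invg invg_lcosets !invGid => CG.
have [GC DC] := rcosets_repr sVG CG.
have : repr (C^-1)%g \in (C^-1)%g.
  by apply: (mem_repr (repr C)^-1%g); rewrite inE invgK {2}DC rcoset_refl.
rewrite inE {2}DC => /rcosetP[v Vv ->].
by rewrite tV.
Qed.

(** The block of index i is brought to the block of V by the inverse of its
    coset representative. *)
Lemma ind_outE i (u : 'cV[k]_(rdegree X)) : submxcol u i = q *m X (coset_rep i)^-1%g *m u.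
Proof.
have Gi := coset_rep_in sVG i.
have -> : q *m X (coset_rep i)^-1%g = \mxrow_l repr0 L ((coset_rep i)^-1 * coset_rep l).
  apply: ind_ext => x Gx.
  rewrite -mulmxA ind_mul_in // ind_out_in_at ?groupM ?groupV //.
  rewrite mul_mxrow_mxcol.
  have := repr0_sum L i Gx 1%g; rewrite mul1g => <-.
  by apply: eq_bigr => l _; rewrite mul1g.
rewrite -[u in RHS]submxcolK mul_mxrow_mxcol (bigD1 i) //=.
rewrite mulVg /repr0 group1 repr_mx1 mul1mx big1 ?addr0 // => l ne_li.
have [m Dm] := coset_rep_ex V (coset_rep_in sVG l).
have /eqP Em : l == m by rewrite -Dm mulVg. 
by rewrite Dm -Em eq_sym (negPf ne_li) mul0mx.
Qed.

Lemma ind_form_matrix (BL : {symmetric 'cV[k]_(rdegree L)})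
    (u v : 'cV[k]_(rdegree X)) :
  intertwines V L (dual L) (form_matrix BL) ->
  ind_form BL u v = (u^T *m ind_mx_form (form_matrix BL) q *m v) 0 0.
Proof.
move=> hA; set A := form_matrix BL in hA *.
have hq := ind_out_hom sVG L.
pose t x := ((q *m X x *m u)^T *m A *m (q *m X x *m v)) 0 0.
have -> : ind_form BL u v = \sum_(i < #|lcosets V G|) t (coset_rep i)^-1%g.
  by apply: eq_bigr => i _; rewrite form_matrixE !ind_outE.
rewrite sum_lcosets_inv => [|y x Vy Gx]; last first.
  have Gy := subsetP sVG y Vy.
  have E (w : 'cV[k]_(rdegree X)) : q *m X (y * x)%g *m w = L y *m (q *m X x *m w).
    by rewrite repr_mxM // [q *m _]mulmxA hq // !mulmxA.
  rewrite /t !E; move: (q *m X x *m u) (q *m X x *m v) => u1 v1.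
  by rewrite -[in RHS](invariant_cancel (subxx V) Vy hA) trmx_mul !mulmxA.
rewrite ind_mx_formE mulmx_sumr mulmx_suml summxE; apply: eq_bigr => C _.
by rewrite /t !trmx_mul !mulmxA.
Qed.

End InducedFormMatrix.

(** * The distinguished component *)

(** The multiple N^1 is N together with the zero module. *)
Lemma has_multiplicity1 (k : fieldType) (gT : finGroupType) (G : {group gT})
    (N X N' : representation k G) a b c d :
  intertwines G N X a -> intertwines G X N b -> b *m a = 1%:M ->
  intertwines G N' X c -> intertwines G X N' d -> d *m c = 1%:M ->
  a *m b + c *m d = 1%:M -> ~ component N N' -> has_multiplicity N X 1.
Proof.
move=> ha hb ba hc hd dc abcd nN'; exists N' => //.
have [inj [prj [hinj hprj prj_inj]]] := muln_decomposition N 1.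
rewrite big_ord1 => inj_prj.
apply: (split_decomposition (intertwinesM (hprj ord0) ha)
          (intertwinesM hb (hinj ord0)) _ hc hd dc).
  by rewrite mulmxA -(mulmxA _ b) ba mulmx1.
by rewrite mulmxA -(mulmxA a) prj_inj eqxx mulmx1.
Qed.

Theorem theorem1p7 (k : closedFieldType) (gT : finGroupType)
    (G V : {group gT}) (sVG : V \subset G) (Z : representation k V) :
  2%N \in [pchar k] -> ~~ odd #|G| -> 2.-group V ->
  indecomposable Z -> is_vertex Z V -> symmetric_type Z ->
  exists2 M : representation k G,
    [/\ indecomposable M, component M (ind sVG Z) & is_vertex M V] &
    forall N : representation k G,
      [/\ indecomposable N, component N (ind sVG Z) & is_vertex N V] ->
      [/\ (* (a) *)
          mx_rsim N M <->
            self_dual N /\ has_multiplicity N (ind sVG Z) 1,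
          (* (b) *)
          mx_rsim N M <->
            self_dual N /\ exists2 m, odd m & has_multiplicity N (ind sVG Z) m,
          (* (c) *)
          mx_rsim N M <->
            exists B : {symmetric 'cV[k]_(rdegree N)},
              Gform N B /\ B_component sVG N B Z
        & (* (d) *)
          mx_rsim N M <->
            forall D : {symmetric 'cV[k]_(rdegree (ind sVG Z))},
              Gform (ind sVG Z) D -> projective_form sVG (ind sVG Z) D ->
              nondegenerate_on_summand (ind sVG Z) N D].
Proof.
move=> char2 _ _ indZ [_ vertexZ] [BZ GBZ].
have [uA invA] := Gform_matrix GBZ; have symA := form_matrix_sym BZ.
have symBE := fun u v => @ind_form_matrix k gT G V sVG Z BZ u v invA.
move: (form_matrix BZ) uA invA symA symBE => A uA invA symA BE.
have indX := ind_induced_along sVG Z.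
have indB := ind_mx_form_induced sVG symA invA indX.
set X := ind sVG Z in indX indB BE *; set j := ind_in sVG Z in indX indB *.
set q := ind_out sVG Z in indX indB BE *.
move: (ind_mx_form A q) indB BE => B indB BE.
have [symB invB _] := indB.
have uB := induced_form_unit sVG uA indX indB.
pose dist := distinguished A j B.
have dist_rsim (N1 N2 : representation k G) : mx_rsim N1 N2 -> dist N2 -> dist N1.
  exact: distinguished_rsim.
have [M indM distM] : exists2 M : representation k G, indecomposable M & dist M.
  exact: (distinguished_indecomposable sVG char2 indZ symA uA invA indX indB).
have dist_comp N : dist N -> component N X.
  by case=> a [b [ha hb ba _]]; apply/componentP; exists a, b.
have dist_vertex N (W : {group gT}) : dist N -> W \proper V -> ~ relatively_projective N W.
  exact: (distinguished_vertex sVG indZ vertexZ uA invA indX indB).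
exists M.
  split=> //; first exact: dist_comp.
  split; last by move=> W; apply: dist_vertex.
  by exists sVG, Z; apply: dist_comp.
move=> N [indN compN [_ vertexN]].
have eqM : mx_rsim N M <-> dist N.
  split=> [simNM | distN]; first exact: dist_rsim simNM distM.
  exact: (distinguished_unique sVG char2 indZ vertexZ symA uA invA indX indB indN indM distN distM).
have of_nondeg u : intertwines G N X u -> u^T *m B *m u \in unitmx -> dist N.
  exact: (nondegenerate_distinguished sVG char2 indZ vertexZ symA uA invA indX indB indN vertexN).
have dist_form a b D : intertwines G N X a -> intertwines G X N b -> b *m a = 1%:M ->
    norm_char A j B (a *m b) != 0 -> intertwines G X (dual X) D -> D \in unitmx ->
    a^T *m D *m a \in unitmx.
  exact: (distinguished_form_unit sVG char2 indZ vertexZ symA uA invA indX indB indN).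
have of_odd : self_dual N /\ (exists2 m, odd m & has_multiplicity N X m) -> dist N.
  case=> sdN [m odd_m multN].
  have [u hu uu] := odd_multiplicity_nondegenerate char2 indN symB uB invB sdN odd_m multN.
  exact: of_nondeg hu uu.
have to_self_dual : dist N -> self_dual N.
  case=> a [b [ha hb ba nz]].
  have uH := dist_form a b B ha hb ba nz invB uB.
  have hH := intertwines_pullback invB ha.
  apply/mx_rsimP; exists (a^T *m B *m a), (invmx (a^T *m B *m a)).
  by split; [exact: hH | exact: intertwinesV uH hH | exact: mulVmx | exact: mulmxV].
have to_mult1 : dist N -> has_multiplicity N X 1.
  case=> a [b [ha hb ba nz]].
  have [N' [c [d [hc hd dc abcd]]]] := split_complement ha hb ba.
  apply: (has_multiplicity1 ha hb ba hc hd dc abcd).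
  exact: (distinguished_not_component sVG char2 indZ vertexZ symA uA invA indX indB
            ha hb ba nz hc hd abcd dc).
split; split.
- by move/eqM=> distN; split; [exact: to_self_dual | exact: to_mult1].
- by case=> sdN mult1; apply/eqM/of_odd; split=> //; exists 1%N.
- by move/eqM=> distN; split; [exact: to_self_dual | exists 1%N => //; exact: to_mult1].
- by move/of_odd/eqM.
- move/eqM=> [a [b [ha hb ba nz]]].
  have uH := dist_form a b B ha hb ba nz invB uB.
  have hH := intertwines_pullback invB ha.
  have symH := tr_bilinear a a symB.
  have [gam hgam ugam] := distinguished_source_component sVG char2 indZ vertexZ
    symA uA invA indX indB indN ha hb ba nz.
  exists (symmetric_of_matrix symH); split; first exact: matrix_Gform uH hH.
  apply/B_component_matrix; exists gam => //.
  by rewrite form_matrix_of_matrix.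
- case=> BN [GBN /B_component_matrix[gam hgam ugam]].
  have [_ hD] := Gform_matrix GBN.
  have [a [b [ha hb ba]]] := iffLR (componentP N X) compN.
  apply/eqM; exists a, b; split=> //.
  exact: (source_component_distinguished sVG char2 indZ vertexZ symA uA invA indX
            indB ha hb ba (form_matrix_sym BN) hD hgam ugam).
- move/eqM=> [a [b [ha hb ba nz]]] D GD _.
  have [uD hD] := Gform_matrix GD.
  apply: (matrix_nondegenerate_on_summand ha hb ba).
  exact: (dist_form a b _ ha hb ba nz hD uD).
move=> nondeg; apply/eqM.
have proj : projective_form sVG X (symmetric_of_matrix symB).
  exists Z, BZ; split=> //; exists 1%:M; split; first exact: intertwines1.
  by move=> u v; rewrite !mul1mx BE.
have [u hu] := nondegenerate_on_summand_matrix (nondeg _ (matrix_Gform symB uB invB) proj).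
rewrite form_matrix_of_matrix; exact: of_nondeg.
Qed.
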